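(* Let $U\in C^2(\mathbb T)$ be a real-valued shear profile with zero mean, $\int_{\mathbb T}U\,dy=0$. Then there exists a constant $\delta_U>0$, depending only on $\|U\|_{C^2}$, such that for all $\nu,\varepsilon,\beta>0$ satisfying $$\frac{\varepsilon}{\nu}(1+\beta)<\delta_U\qquad\text{and}\qquad \varepsilon<\frac{\beta}{\nu},$$ the operator $\mathcal L_{\nu,\varepsilon,\beta}$ has a simple eigenvalue $\lambda^{(0)}_{\nu,\varepsilon,\beta}$ satisfying $$\mathrm{Re}\,\lambda^{(0)}_{\nu,\varepsilon,\beta}=\frac{\varepsilon^2}{\nu}\left[-\nu^2-\left\langle U,\left(\partial_y^4+\frac{\beta^2}{\varepsilon^2\nu^2}\right)^{-1}U''\right\rangle+\mathcal O\!\left(\frac{\varepsilon}{\nu}(1+\beta)^3\right)\right],$$ where $\mathcal O(\kappa)$ denotes a quantity bounded in absolute value by $C\kappa$ with $C>0$ independent of $\varepsilon,\nu,\beta$.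
   Context: $\mathbb T=\mathbb R/2\pi\mathbb Z$, and $L^2=L^2(\mathbb T)$ (complex-valued functions) carries the normalized inner product $\langle f,g\rangle=\frac1{2\pi}\int_{\mathbb T}\overline{f}\,g\,dy$. For $\nu,\varepsilon,\beta>0$, the operator $\mathcal L_{\nu,\varepsilon,\beta}:H^2(\mathbb T)\subset L^2(\mathbb T)\to L^2(\mathbb T)$ is $$\mathcal L_{\nu,\varepsilon,\beta}:=\nu(\partial_{yy}-\varepsilon^2)-\mathrm i\,\varepsilon\Big(U(y)-(U''(y)-\beta)(\partial_{yy}-\varepsilon^2)^{-1}\Big),$$ where $U(y)$ and $U''(y)-\beta$ act by multiplication. It is the $x$-Fourier mode of the linearization of the 2D Navier–Stokes equations on the $\beta$-plane (viscosity $\nu$, Coriolis parameter $\beta$) around the shear flow $(U(y),0)$, with $\varepsilon$ the long-wave parameter. *)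

(* Defs.v *)
From mathcomp Require Import all_boot all_order all_algebra.
From mathcomp Require Import all_classical all_reals all_analysis.
From mathcomp Require Export complex.
Import numFieldNormedType.Exports.

Set Implicit Arguments.
Unset Strict Implicit.
Unset Printing Implicit Defensive.

Import Order.TTheory GRing.Theory Num.Theory.

Local Open Scope classical_set_scope.
Local Open Scope ring_scope.
Local Open Scope complex_scope.

(* The circle R/2piZ is represented by its fundamental domain [0, 2pi]:
   an element of L^2 is given by any function on the line that is square
   integrable on [0, 2pi], its values elsewhere being irrelevant, and two such
   functions are identified when they agree a.e. on [0, 2pi].  Functions whose
   pointwise regularity on the circle matters are 2pi-periodic on the line. *)
Section Circle.
Context (R : realType).
Implicit Types (f g : R -> R[i]) (u phi : R -> R).

Definition circle : set R := `[0, pi *+ 2].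

Definition ae_circle f g : Prop := ae_eq lebesgue_measure circle f g.

Definition cintegral f : R[i] :=
  (\int[lebesgue_measure]_(y in circle) complex.Re (f y)) +i*
  (\int[lebesgue_measure]_(y in circle) complex.Im (f y)).

Definition inner f g : R[i] :=
  ((pi *+ 2)^-1)%:C * cintegral (fun y => (f y)^* * g y).

Definition L2 f : Prop :=
  [/\ measurable_fun circle (fun y => complex.Re (f y)),
      measurable_fun circle (fun y => complex.Im (f y)) &
      lebesgue_measure.-integrable circle
        (fun y => (complex.Re (f y) ^+ 2 + complex.Im (f y) ^+ 2)%:E)].

Definition is_Ck (k : nat) u : Prop :=
  [/\ periodic u (pi *+ 2),
      forall j y, (j < k)%N -> derivable (derive1n j u) y 1 &
      continuous (derive1n k u)].

Definition Ck_norm (k : nat) u : R :=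
  \sum_(j < k.+1) sup (range (fun y => `|derive1n j u y|)).

(* Test functions are real-valued and of class C^1 on the circle, the usual
   choice for W^{1,p}; real ones suffice since f and g are complex-valued and
   the identity is tested on real and imaginary parts at once. *)
Definition weak_deriv f g : Prop :=
  [/\ L2 f, L2 g &
      forall phi, is_Ck 1 phi ->
        cintegral (fun y => f y * (derive1 phi y)%:C) =
        - cintegral (fun y => g y * (phi y)%:C)].

Fixpoint sobolev (k : nat) f : Prop :=
  if k is k'.+1 then exists2 g, weak_deriv f g & sobolev k' g else L2 f.

(* Weak derivatives are unique a.e.; xget selects a representative. *)
Definition Dy f : R -> R[i] := xget (fun=> 0) [set g | weak_deriv f g].

Definition Dyn (k : nat) f : R -> R[i] := iter k Dy f.

End Circle.

Arguments circle {R}.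

Section Operators.
Context (R : realType).
Implicit Types (f g : R -> R[i]) (dom : (R -> R[i]) -> Prop)
  (A : (R -> R[i]) -> R -> R[i]).

(* The value at g of the inverse of the operator A with domain dom. *)
Definition op_inv dom A g : R -> R[i] :=
  xget (fun=> 0) [set f | dom f /\ ae_circle (A f) g].

Fixpoint ker_pow dom A (lambda : R[i]) (n : nat) f : Prop :=
  if n is n'.+1 then
    dom f /\ ker_pow dom A lambda n' (fun y => A f y - lambda * f y)
  else ae_circle f (fun=> 0).

(* Simplicity is algebraic: the generalized eigenspace, the union of the
   kernels of (A - lambda)^n over all n, is the line spanned by f. *)
Definition simple_eigenvalue dom A (lambda : R[i]) : Prop :=
  exists f, [/\ dom f,
    ~ ae_circle f (fun=> 0),
    ae_circle (A f) (fun y => lambda * f y) &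
    forall n g, ker_pow dom A lambda n g ->
      exists c : R[i], ae_circle g (fun y => c * f y)].

Definition helmholtz (eps : R) f : R -> R[i] :=
  fun y => Dyn 2 f y - (eps ^+ 2)%:C * f y.

Definition Lop (U : R -> R) (nu eps beta : R) f : R -> R[i] :=
  fun y => nu%:C * helmholtz eps f y
    - 'i * eps%:C *
      ((U y)%:C * f y
       - (derive1n 2 U y - beta)%:C * op_inv (sobolev 2) (helmholtz eps) f y).

Definition biharmonic (c : R) f : R -> R[i] :=
  fun y => Dyn 4 f y + c%:C * f y.

End Operators.

(* Main.v *)
(* Write the eigenfunction as f = -eps^2 + h with h of zero mean; then
   (d_yy - eps^2)^-1 f = 1 + phi with phi'' - eps^2 phi = h.  Put eta = eps/nu,
   b = beta/(eps nu) and s = <U, phi>.  Since <U h> - <U'' phi> = - eps^2 s, the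
   mean of the eigenvalue equation says
     lambda = - nu eps^2 + i beta/eps - i eps s,
   and its zero-mean part becomes
     h'' - i b h = - i eta (eps^2 U + U'')
                   + i eta (U h - U'' phi + eps^2 s + beta phi - s h).
   On zero-mean functions d_yy - z with Re z >= 0 is invertible in the sup norm
   with a bound independent of z (an energy estimate, then continuation in z), so
   for eta (1 + beta) small h is obtained as a fixed point of a contraction.  As
   eps < beta/nu gives eps^2 <= eta beta, the leading term is phi = - i eta v with
   v'' - i b v = U, and Re v = (d_y^4 + b^2)^-1 U''.  If (L - lambda) g = a f,
   subtracting a multiple of f makes g mean-free; the mean of the equation then
   determines a, and the zero-mean part is the linearisation of the equation for
   h, which is injective by the same estimates: lambda is algebraically simple.
   All functions in H^2 or H^4 that occur agree a.e. with classical solutions,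
   because a function with a weak derivative is a.e. a continuous primitive of it. *)
Require Import Defs.
From mathcomp Require Import all_boot all_order all_algebra.
From mathcomp Require Import all_classical all_reals all_analysis.
From mathcomp Require Import measurable_realfun ring lra.
Import numFieldNormedType.Exports.
Import Order.TTheory GRing.Theory Num.Theory.
Local Open Scope classical_set_scope.
Local Open Scope ring_scope.
Local Open Scope complex_scope.

Set Implicit Arguments.
Unset Strict Implicit.
Unset Printing Implicit Defensive.

(** The obstacle is the constant mode: on constants (d_yy - eps^2)^-1 is multiplication by -eps^-2,
    so the nonlocal term of the operator is not a small perturbation when eps is small. Giving f the
    mean -eps^2 makes the stream function 1 + phi, of order one, and negative powers of eps
    disappear from the equation for h. The price is a quadratic term, since lambda itself contains
    <U, phi>.

    The parameter b is unbounded, so the linear bound must not see it. Pairing v'' - z v = k with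
    the conjugate of v and taking real parts removes Im z, which gives the constant [Kper] for all z
    with Re z >= 0. On the unit ball of the sup norm the bracket multiplied by i eta has Lipschitz
    constant at most (1 + beta) [Lam M]. Existence, size, leading order and simplicity all rest on
    the single condition Kper eta (1 + beta) Lam(M) <= 1/2, and this is why delta depends on the C^2
    norm of U alone. The remainder obtained is O(eta (1 + beta)), which is bounded by the cubic one.

    [Dy] and [op_inv] are choices of representatives; each use of them needs existence of a
    candidate and its uniqueness up to null sets. *)

Ltac nonneg := repeat first
  [assumption | by apply: ltW | by apply: sqr_ge0 | apply: mulr_ge0 | apply: addr_ge0 | by []].

(** * Calculus on the circle *)

Section Derivatives.
Context (R : realType).
Implicit Types (f g u v F : R -> R) (a b x y : R).
Local Notation mu := (@lebesgue_measure R).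
Local Notation per := (pi *+ 2 : R).
Local Notation Int f := (\int[mu]_(y in circle) f y).

Definition has_deriv F f := forall y, is_derive y (1 : R) F (f y).
Definition pcont u := periodic u per /\ continuous u.

Lemma per_gt0 : 0 < per.
Proof. by rewrite mulrn_wgt0 // pi_gt0. Qed.

Lemma has_deriv_continuous F f : has_deriv F f -> continuous F.
Proof.
by move=> d y; apply/differentiable_continuous/derivable1_diffP; case: (d y).
Qed.

Lemma has_derivD F f G g : has_deriv F f -> has_deriv G g ->
  has_deriv (fun y => F y + G y) (fun y => f y + g y).
Proof. by move=> dF dG y; have := dF y; have := dG y => ? ?; exact: is_deriveD. Qed.

Lemma has_derivZ F f c : has_deriv F f ->
  has_deriv (fun y => c * F y) (fun y => c * f y).
Proof. by move=> dF y; have := dF y => ?; exact: is_deriveZ. Qed.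

Lemma has_derivN F f : has_deriv F f ->
  has_deriv (fun y => - F y) (fun y => - f y).
Proof. by move=> dF y; have := dF y => ?; exact: is_deriveN. Qed.

Lemma has_derivB F f G g : has_deriv F f -> has_deriv G g ->
  has_deriv (fun y => F y - G y) (fun y => f y - g y).
Proof. by move=> dF dG; apply: has_derivD => //; exact: has_derivN. Qed.

Lemma has_deriv_cst c : has_deriv (fun=> c) (fun=> 0).
Proof. by move=> y; exact: is_derive_cst. Qed.

Lemma has_deriv_id : has_deriv (fun y => y) (fun=> 1).
Proof. by move=> y; exact: is_derive_id. Qed.

Lemma has_derivM F f G g : has_deriv F f -> has_deriv G g ->
  has_deriv (fun y => F y * G y) (fun y => F y * g y + f y * G y).
Proof.
move=> dF dG y; have := dF y; have := dG y => ? ?.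
apply: is_derive_eq (@is_deriveM _ _ F G y 1 (f y) (g y) _ _) _.
by rewrite /GRing.scale /= [G y * f y]mulrC.
Qed.

Lemma has_deriv_eq F f g : has_deriv F f -> f =1 g -> has_deriv F g.
Proof. by move=> dF /funext E; rewrite -E. Qed.

Lemma has_deriv_shift F f c : has_deriv F f ->
  has_deriv (fun y => F (y + c)) (fun y => f (y + c)).
Proof.
move=> dF y; have := dF (y + c) => ?.
have ? : is_derive y (1 : R) (fun z => z + c) 1.
  by have := has_derivD has_deriv_id (has_deriv_cst c) y; rewrite addr0.
by rewrite -[f _]mulr1; exact: (@is_derive1_comp _ F (fun z => z + c)).
Qed.

Lemma has_deriv0_cst F x y : has_deriv F (fun=> 0) -> F x = F y.
Proof. by move=> d; exact: is_derive_0_is_cst. Qed.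

Lemma has_deriv_homo F f : has_deriv F f -> (forall y, 0 <= f y) ->
  forall x y, x <= y -> F x <= F y.
Proof.
move=> d f0 x y xy; have [| c _ E] := @MVT_segment _ F f x y xy (fun z _ => d z).
  by apply: continuous_subspaceT => z; exact: has_deriv_continuous d z.
by rewrite -subr_ge0 E mulr_ge0 // subr_ge0.
Qed.

Lemma has_derivE F f : has_deriv F f -> derive1 F = f.
Proof. by move=> d; apply/funext => y; rewrite derive1E; exact: derive_val. Qed.

Lemma continuous_itv_integrable f a b : continuous f ->
  mu.-integrable `[a, b] (EFin \o f).
Proof.
move=> cf; apply: continuous_compact_integrable; first exact: segment_compact.
by apply: continuous_subspaceT => z; exact: cf.
Qed.

Lemma FTC2 F f a b : has_deriv F f -> continuous f -> a <= b ->
  \int[mu]_(x in `[a, b]) f x = F b - F a.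
Proof.
move=> d cf; rewrite le_eqVlt => /predU1P[->|ab].
  by rewrite set_itv1 Rintegral_set1 subrr.
have cF := has_deriv_continuous d.
rewrite /Rintegral (@continuous_FTC2 _ f F)//.
- by apply: continuous_subspaceT => z; exact: cf.
- split.
  + by move=> x _; case: (d x).
  + by apply: cvg_at_right_filter; exact: cF.
  + by apply: cvg_at_left_filter; exact: cF.
- by move=> x _; rewrite (has_derivE d).
Qed.

(** The fundamental theorem differentiates the integral from [a] to [y] only for [a < y]. The
    primitive on the whole line is glued from integrals based at 0, and near each point it
    coincides, up to a constant, with an integral based further left. *)
Lemma primitive_exists f : continuous f -> exists F, has_deriv F f.
Proof.
move=> cf.
pose P a y := \int[mu]_(t in `[a, y]) f t.
have dP a y : a < y -> is_derive y (1 : R) (P a) (f y).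
  move=> ay.
  have [||D E] := @continuous_FTC1_closed _ f a y (y + 1) _ _ ay (cf y).
  - by rewrite ltrDl.
  - exact: continuous_itv_integrable.
  by split; [exact: D|rewrite -derive1E].
pose F y := if 0 <= y then P 0 y else - P y 0.
have FE a y : a < 0 -> a < y -> F y = P a y - P a 0.
  move=> a0 ay; rewrite /F; case: ifPn => [y0|]; last rewrite -ltNge => y0.
    rewrite /P Rintegral_itvB ?bnd_simp //;
      [|exact: continuous_itv_integrable|exact: ltW].
    rewrite -Rintegral_itv_obnd_cbnd //.
    by apply: (@integrableS _ _ _ mu `[0, y]) => //;
      [exact: subset_itv_oc_cc|exact: continuous_itv_integrable].
  rewrite -opprB; congr (- _).
  rewrite /P Rintegral_itvB ?bnd_simp //;
    [|exact: continuous_itv_integrable|exact: ltW|exact: ltW].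
  rewrite Rintegral_itv_obnd_cbnd //.
  by apply: (@integrableS _ _ _ mu `[y, 0]) => //;
      [exact: subset_itv_oc_cc|exact: continuous_itv_integrable].
exists F => y.
(* A base point to the left of both 0 and [y]. *)
pose a := - `|y| - 1.
have a0 : a < 0 by rewrite /a; have := normr_ge0 y; lra.
have ay : a < y by rewrite /a; have := ler_norm (- y); rewrite normrN; lra.
have D : is_derive y (1 : R) (fun z => P a z - P a 0) (f y).
  have := dP a y ay => ?.
  by rewrite -[f y]subr0; exact: (@is_deriveB _ _ _ (P a) (cst (P a 0)) y 1 (f y) 0).
apply: near_eq_is_derive D.
near=> z; apply/esym/FE => //.
near: z; exact: lt_nbhsr.
Unshelve. all: by end_near. Qed.
End Derivatives.

(** * Continuous periodic functions and their integrals *)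

Section PeriodicFunctions.
Context (R : realType).
Implicit Types (f g u v F : R -> R) (a b x y : R).
Local Notation mu := (@lebesgue_measure R).
Local Notation per := (pi *+ 2 : R).
Local Notation Int f := (\int[mu]_(y in circle) f y).

Lemma continuousD_fun f g : continuous f -> continuous g ->
  continuous (fun y => f y + g y).
Proof. by move=> cf cg y; apply: continuousD; [exact: cf|exact: cg]. Qed.

Lemma continuousM_fun f g : continuous f -> continuous g ->
  continuous (fun y => f y * g y).
Proof. by move=> cf cg y; apply: continuousM; [exact: cf|exact: cg]. Qed.

Lemma continuousN_fun f : continuous f -> continuous (fun y => - f y).
Proof. by move=> cf y; apply: continuousN; exact: cf. Qed.

Lemma pcont_cst (c : R) : pcont (fun _ : R => c).
Proof. by split => // y; exact: cst_continuous. Qed.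

Lemma pcontD f g : pcont f -> pcont g -> pcont (fun y => f y + g y).
Proof.
by move=> [pf cf] [pg cg]; split; [move=> y; rewrite pf pg|exact: continuousD_fun].
Qed.

Lemma pcontM f g : pcont f -> pcont g -> pcont (fun y => f y * g y).
Proof.
by move=> [pf cf] [pg cg]; split; [move=> y; rewrite pf pg|exact: continuousM_fun].
Qed.

Lemma pcontN f : pcont f -> pcont (fun y => - f y).
Proof. by move=> [pf cf]; split; [move=> y; rewrite pf|exact: continuousN_fun]. Qed.

Lemma pcontB f g : pcont f -> pcont g -> pcont (fun y => f y - g y).
Proof. by move=> cf cg; apply: pcontD => //; exact: pcontN. Qed.

Lemma has_deriv_periodic F f : has_deriv F f -> periodic F per -> periodic f per.
Proof.
move=> d pF y.
have : has_deriv F (fun y => f (y + per)).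
  rewrite [X in has_deriv X _](_ : F = fun y => F (y + per)).
    exact: has_deriv_shift.
  by apply/funext => z; rewrite pF.
move=> /has_derivE; rewrite (has_derivE d) => E.
by rewrite [in RHS]E.
Qed.

Lemma periodic_reduce y : exists2 x, circle x & forall u, periodic u per -> u y = u x.
Proof.
have p0 := (per_gt0 R).
pose n := Num.floor (y / per).
have /andP[nl nr] := floor_itv (y / per).
have shift u (k : int) : periodic u per -> forall x, u (x + per *~ k) = u x.
  move=> pu x; case: k => k; first by rewrite -pmulrn periodicn.
  rewrite NegzE mulrNz -pmulrn -[in RHS](subrK (per *+ k.+1) x).
  by rewrite (periodicn pu).
exists (y - per *~ n); last first.
  by move=> u pu; rewrite -mulrNz shift.
rewrite /circle /= in_itv /= -mulrzl.
move: nl nr; rewrite -/n ler_pdivlMr // ltr_pdivrMr // intrD => nl nr.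
by rewrite subr_ge0 nl /= lerBlDr; move: (ltW nr); rewrite mulrDl mul1r addrC.
Qed.

Lemma pcont_bounded u : pcont u -> exists2 B, 0 < B & forall y, `|u y| <= B.
Proof.
move=> [pu cu].
have [M [_ MP]] : bounded_set (u @` circle).
  apply: compact_bounded; apply: continuous_compact; last exact: segment_compact.
  by apply: continuous_subspaceT => z; exact: cu.
exists (`|M| + 1); first by rewrite ltr_wpDl.
move=> y; have [x xc ->] := periodic_reduce y => //.
by apply: (MP (`|M| + 1)); [rewrite (le_lt_trans (ler_norm _)) // ltrDl|exists x].
Qed.

Lemma periodic_eq_circle u v : periodic u per -> periodic v per ->
  (forall y, circle y -> u y = v y) -> u = v.
Proof.
move=> pu pv uv; apply/funext => y; have [x xc E] := periodic_reduce y.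
by rewrite E // uv // E.
Qed.

Lemma measurable_circle : measurable (circle : set (measurableTypeR R)).
Proof. exact: measurable_itv. Qed.
Hint Resolve measurable_circle : core.

Lemma continuous_circle_integrable f : continuous f -> mu.-integrable circle (EFin \o f).
Proof. exact: continuous_itv_integrable. Qed.

Lemma Int_cst c : Int (fun=> c) = per * c.
Proof.
rewrite Rintegral_cst // mulrC; congr (_ * _).
have E : mu circle = per%:E.
  by rewrite /circle lebesgue_measure_itv /= lte_fin (per_gt0 R) -EFinB subr0.
by move/(congr1 fine): E.
Qed.

Lemma IntD f g : continuous f -> continuous g ->
  Int (fun y => f y + g y) = Int f + Int g.
Proof. by move=> cf cg; rewrite RintegralD //; exact: continuous_circle_integrable. Qed.

Lemma IntZ c f : continuous f -> Int (fun y => c * f y) = c * Int f.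
Proof. by move=> cf; rewrite RintegralZl //; exact: continuous_circle_integrable. Qed.

Lemma IntN f : continuous f -> Int (fun y => - f y) = - Int f.
Proof.
move=> cf; rewrite -mulN1r -IntZ //.
by congr Rintegral; apply/funext => y; rewrite mulN1r.
Qed.

Lemma IntB f g : continuous f -> continuous g ->
  Int (fun y => f y - g y) = Int f - Int g.
Proof. by move=> cf cg; rewrite RintegralB //; exact: continuous_circle_integrable. Qed.

Lemma Int_le f g : continuous f -> continuous g -> (forall y, f y <= g y) ->
  Int f <= Int g.
Proof.
by move=> cf cg fg; apply: le_Rintegral => //; exact: continuous_circle_integrable.
Qed.

Lemma Int_norm_le f B : continuous f -> (forall y, `|f y| <= B) ->
  `|Int f| <= per * B.
Proof.
move=> cf fB; rewrite ler_norml -mulrN -!Int_cst; apply/andP; split;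
  by apply: Int_le => //; try exact: cst_continuous; move=> y;
  have := fB y; rewrite ler_norml => /andP[].
Qed.

Lemma Int_deriv F f : has_deriv F f -> continuous f -> periodic F per -> Int f = 0.
Proof.
move=> d cf pF; rewrite (FTC2 d cf (ltW (per_gt0 R))).
by rewrite -[per]add0r pF subrr.
Qed.

Lemma Int_primitive F f : has_deriv F f -> continuous f -> Int f = F per - F 0.
Proof. by move=> d cf; rewrite (FTC2 d cf (ltW (per_gt0 R))). Qed.

(** For a primitive F0, the function F0(y + per) - F0(y) has zero derivative and equals the integral
    of [f] at 0, so F0 is periodic; subtracting its mean normalises it. *)
Lemma pcont_primitive f : pcont f -> Int f = 0 ->
  exists F, [/\ has_deriv F f, pcont F & Int F = 0].
Proof.
move=> [pf cf] If; have [F0 dF0] := primitive_exists cf.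
have pF0 : periodic F0 per.
  move=> y; apply/eqP; rewrite -subr_eq0; apply/eqP.
  have := @has_deriv0_cst _ (fun z => F0 (z + per) - F0 z) y 0.
  rewrite add0r -(Int_primitive dF0 cf) If; apply.
  apply: has_deriv_eq (has_derivB (has_deriv_shift per dF0) dF0) _ => z.
  by rewrite pf subrr.
have cF0 := has_deriv_continuous dF0.
exists (fun y => F0 y - Int F0 / per); split.
- by apply: has_deriv_eq (has_derivB dF0 (has_deriv_cst _)) _ => z; rewrite subr0.
- by apply: pcontB => //; exact: pcont_cst.
- rewrite IntB //; last exact: cst_continuous.
  by rewrite Int_cst mulrC divfK ?subrr // gt_eqF // (per_gt0 R).
Qed.

(** A primitive of f^2 is nondecreasing with equal values at 0 and [per], hence constant between
    them. So [f] vanishes inside, at 0 by the limit from the right, and at [per] by periodicity. *)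
Lemma Int_sqr_eq0 f : pcont f -> Int (fun y => f y * f y) = 0 -> f = fun=> 0.
Proof.
move=> [pf cf] I0; have cff := continuousM_fun cf cf.
have [F dF] := primitive_exists cff.
have F0 : F per = F 0 by apply/eqP; rewrite -subr_eq0 -(Int_primitive dF cff) I0.
have hF := has_deriv_homo dF (fun y => sqr_ge0 _).
have Fc y : 0 <= y <= per -> F y = F 0.
  by move=> /andP[y0 y1]; apply/eqP; rewrite eq_le (hF 0 y) // andbT -F0 hF.
have f0 y : 0 < y < per -> f y = 0.
  move=> /andP[y0 y1]; apply/eqP; rewrite -sqrf_eq0; apply/eqP; rewrite expr2.
  have D : is_derive y (1 : R) F 0.
    apply: (@near_eq_is_derive _ _ _ (cst (F 0))).
    near=> z; apply/esym/Fc; apply/andP; split; apply/ltW; near: z;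
      [exact: lt_nbhsr|exact: lt_nbhsl].
  by have <- := @derive_val _ _ _ _ _ _ _ (dF y); rewrite (@derive_val _ _ _ _ _ _ _ D).
apply: periodic_eq_circle => //= y; rewrite /circle /= in_itv /= => /andP[y0 y1].
have f00 : f 0 = 0.
  have /(cvg_lim (@Rhausdorff _)) <- : f z @[z --> 0^'+] --> f 0.
    by apply: cvg_at_right_filter; exact: cf.
  apply: lim_near_cst; first exact: Rhausdorff.
  near=> z; apply: f0; apply/andP; split; near: z; first exact: nbhs_right_gt.
  by apply: nbhs_right_lt; exact: (per_gt0 R).
have [->//|yn0] := eqVneq y 0.
have [->|yn1] := eqVneq y per; first by rewrite -[per]add0r pf.
by apply: f0; rewrite !lt_def yn0 y0 y1 eq_sym yn1.
Unshelve. all: by end_near. Qed.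

End PeriodicFunctions.

(** * Oscillation, absorption and limits for real functions *)

Section RealEstimates.
Context (R : realType).
Implicit Types (f g u v F : R -> R) (a b x y : R).
Local Notation mu := (@lebesgue_measure R).
Local Notation per := (pi *+ 2 : R).
Local Notation Int f := (\int[mu]_(y in circle) f y).

(** A Sobolev inequality with a free parameter in place of Cauchy-Schwarz: from (p1 + s)^2 >= 0 and
    (p1 - s)^2 >= 0, the functions G + s^2 y + 2 s p and G + s^2 y - 2 s p are nondecreasing, where
    G' = g >= p1^2. This bounds the oscillation of [p], and a function of zero mean is bounded by
    its oscillation. *)
Lemma oscillation p p1 g s : periodic p per -> has_deriv p p1 ->
  continuous g -> (forall y, p1 y ^+ 2 <= g y) -> Int p = 0 -> 0 < s ->
  forall y, `|p y| <= (Int g + per * s ^+ 2) / (2 * s).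
Proof.
move=> pp dp cg pg Ip s0.
have cp := has_deriv_continuous dp.
have [G dG] := primitive_exists cg.
have hG := has_deriv_homo dG (fun y => le_trans (sqr_ge0 _) (pg y)).
have dE c : c = 2 * s \/ c = - (2 * s) ->
    forall x y, x <= y -> G x + s ^+ 2 * x + c * p x <= G y + s ^+ 2 * y + c * p y.
  move=> cs; apply: has_deriv_homo (has_derivD (has_derivD dG
    (has_derivZ (s ^+ 2) (@has_deriv_id R))) (has_derivZ c dp)) _ => y.
  have := pg y; have := sqr_ge0 (p1 y + s); have := sqr_ge0 (p1 y - s).
  by rewrite !expr2; case: cs => ->; lra.
pose A := (Int g + per * s ^+ 2) / (2 * s).
have s2 : 0 < 2 * s by rewrite mulr_gt0.
have AE : A * (2 * s) = Int g + per * s ^+ 2 by rewrite divfK // gt_eqF.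
rewrite (Int_primitive dG cg) in AE.
have osc0 x y : circle x -> circle y -> p y - p x <= A.
  rewrite /circle /= !in_itv /= => /andP[x0 x1] /andP[y0 y1].
  rewrite -(ler_pM2r s2) AE.
  have ss : 0 <= s ^+ 2 by exact: sqr_ge0.
  have [xy|/ltW yx] := leP x y.
    have := dE (- (2 * s)) (or_intror erefl) _ _ xy.
    have := hG _ _ x0; have := hG _ _ y1.
    have : s ^+ 2 * (y - x) <= s ^+ 2 * per by apply: ler_wpM2l => //; lra.
    by lra.
  have := dE (2 * s) (or_introl erefl) _ _ yx.
  have := hG _ _ y0; have := hG _ _ x1.
  have : s ^+ 2 * (x - y) <= s ^+ 2 * per by apply: ler_wpM2l => //; lra.
  by lra.
have osc x y : p y - p x <= A.
  have [x' cx ->] := periodic_reduce x => //.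
  by have [y' cy ->] := periodic_reduce y => //; exact: osc0.
have ccst (c : R) : continuous (fun _ : R => c) by move=> ?; exact: cst_continuous.
move=> y; rewrite -/A ler_norml -(ler_pM2l (per_gt0 R)) -[X in _ && X](ler_pM2l (per_gt0 R)).
apply/andP; split.
- have : Int (fun x => p x - p y) <= Int (fun x => A).
    by apply: Int_le => //; exact: continuousD_fun (continuousN_fun _).
  by rewrite IntB // Ip !Int_cst; lra.
- have : Int (fun x => p y - p x) <= Int (fun x => A).
    by apply: Int_le => //; exact: continuousD_fun (continuousN_fun _).
  by rewrite IntB // Ip !Int_cst subr0.
Qed.

(** Absorption: [2 * c] is the fixed point of m -> c + m/2, and iterating from any a priori bound
    [B] leaves an excess of B / 2^n. Bounds that refer to the size of the unknown itself are closed
    in this way. *)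
Lemma le_double_of_halving u c : (forall y, 0 <= u y) ->
  (exists2 B, 0 < B & forall y, u y <= B) ->
  (forall m, 0 < m -> (forall y, u y <= m) -> forall y, u y <= c + m / 2) ->
  0 <= c -> forall y, u y <= 2 * c.
Proof.
move=> u0 [B B0 uB] half c0.
have it n y : u y <= 2 * c + B / 2 ^+ n.
  elim: n y => [|n IH] y; first by rewrite expr0 divr1 (le_trans (uB y)) // lerDr mulr_ge0.
  have m0 : 0 < 2 * c + B / 2 ^+ n.
    by rewrite ltr_wpDl ?mulr_ge0 // divr_gt0 // exprn_gt0.
  apply: le_trans (half _ m0 IH y) _.
  by rewrite exprSr invfM mulrA; lra.
move=> y; apply/ler_addgt0Pr => e e0.
have [n ne] : exists n, B / 2 ^+ n <= e.
  have [n _ Hn] := near_infty_natSinv_expn_lt (PosNum (divr_gt0 e0 B0)).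
  exists n; have /= := ltW (Hn n (leqnn n)).
  by rewrite div1r ler_pdivlMr // mulrC.
by apply: le_trans (it n y) _; rewrite lerD2l.
Qed.

(** The intervals of radius 2 m / 2^n around [x n] are nested, and the supremum of their left ends
    lies in all of them. *)
Lemma geometric_limit (x : nat -> R) m :
  (forall n, `|x n.+1 - x n| <= m / 2 ^+ n) ->
  exists l, forall n, `|x n - l| <= 2 * m / 2 ^+ n.
Proof.
move=> xm.
pose h n : R := m / 2 ^+ n.
have hS n : 2 * h n.+1 = h n by rewrite /h exprSr invfM; field.
have m0 n : 0 <= h n by exact: le_trans (normr_ge0 _) (xm n).
have xm' n : x n - h n <= x n.+1 <= x n + h n.
  by have := xm n; rewrite ler_norml -/(h n); lra.
have aS n k : x n - 2 * h n <= x (n + k)%N - 2 * h (n + k)%N.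
  by elim: k => [|k IH]; rewrite ?addn0 // addnS; apply: le_trans IH _;
    have := xm' (n + k)%N; have := hS (n + k)%N; lra.
have bS n k : x (n + k)%N + 2 * h (n + k)%N <= x n + 2 * h n.
  by elim: k => [|k IH]; rewrite ?addn0 // addnS; apply: le_trans _ IH;
    have := xm' (n + k)%N; have := hS (n + k)%N; lra.
have ab i j : x i - 2 * h i <= x j + 2 * h j.
  have := aS i j; have := bS j i; rewrite addnC; have := m0 (i + j)%N; lra.
pose S := range (fun n => x n - 2 * h n).
have hS' : has_sup S.
  by split; [exists (x 0%N - 2 * h 0%N), 0%N|
    exists (x 0%N + 2 * h 0%N) => _ [i _ <-]; exact: ab].
exists (sup S) => n.
have l1 : x n - 2 * h n <= sup S by apply: ub_le_sup; [case: hS'|exists n].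
have l2 : sup S <= x n + 2 * h n by apply: ge_sup; [case: hS'|move=> _ [i _ <-]; exact: ab].
by rewrite -mulrA -/(h n) ler_norml; lra.
Qed.

Lemma pcont_uniform_limit u :
  (forall e : R, 0 < e -> exists2 v, pcont v & forall y, `|u y - v y| <= e) -> pcont u.
Proof.
move=> H; split.
- move=> y; apply/eqP; rewrite -subr_eq0 -normr_le0; apply/ler_addgt0Pr => e e0.
  have e2 : 0 < e / 2 by rewrite divr_gt0.
  have [v [pv _] uv] := H _ e2.
  have := uv y; have := uv (y + per); rewrite pv add0r !ler_norml; lra.
- move=> y; apply/cvgrPdist_le => e e0.
  have e3 : 0 < e / 3 by rewrite divr_gt0.
  have [v [_ cv] uv] := H _ e3.
  have /cvgrPdist_le /(_ _ e3) := cv y; apply: filterS => z.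
  have := uv y; have := uv z; rewrite !ler_norml; lra.
Qed.

End RealEstimates.

(** * Complex-valued functions and a contraction principle *)

Section ComplexFunctions.
Context (R : realType).
Implicit Types (a b x y : R) (u : R -> R) (z w c : R[i]) (f g h k v : R -> R[i]).
Local Notation mu := (@lebesgue_measure R).
Local Notation per := (pi *+ 2 : R).
Local Notation Int f := (\int[mu]_(y in circle) f y).

Local Notation normc := (@Normc.normc R).
Local Notation Re := (@complex.Re R).
Local Notation Im := (@complex.Im R).

Definition cpcont f := pcont (fun y => Re (f y)) /\ pcont (fun y => Im (f y)).
Definition chas_deriv f g :=
  has_deriv (fun y => Re (f y)) (fun y => Re (g y)) /\
  has_deriv (fun y => Im (f y)) (fun y => Im (g y)).

Lemma complex_ReD z w : Re (z + w) = Re z + Re w. Proof. by case: z; case: w. Qed.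
Lemma complex_ImD z w : Im (z + w) = Im z + Im w. Proof. by case: z; case: w. Qed.
Lemma complex_ReN z : Re (- z) = - Re z. Proof. by case: z. Qed.
Lemma complex_ImN z : Im (- z) = - Im z. Proof. by case: z. Qed.
Lemma complex_ReM z w : Re (z * w) = Re z * Re w - Im z * Im w.
Proof. by case: z; case: w. Qed.
Lemma complex_ImM z w : Im (z * w) = Re z * Im w + Im z * Re w.
Proof. by case: z; case: w. Qed.
Definition ReImE := (complex_ReD, complex_ImD, complex_ReN, complex_ImN, complex_ReM, complex_ImM).

Lemma complex_eqP z w : Re z = Re w -> Im z = Im w -> z = w.
Proof. by case: z => a b; case: w => a' b' /= -> ->. Qed.

Lemma normc_ge0 z : 0 <= normc z.
Proof. by case: z => a b; exact: Num.Theory.sqrtr_ge0. Qed.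

Lemma normc_sqr z : normc z ^+ 2 = Re z ^+ 2 + Im z ^+ 2.
Proof. by case: z => a b; rewrite /= sqr_sqrtr // addr_ge0 // sqr_ge0. Qed.

Lemma normRe_le z : `|Re z| <= normc z.
Proof.
rewrite -(ler_pXn2r (n := 2)) ?nnegrE ?normc_ge0 // real_normK ?num_real //.
by rewrite normc_sqr lerDl sqr_ge0.
Qed.

Lemma normIm_le z : `|Im z| <= normc z.
Proof.
rewrite -(ler_pXn2r (n := 2)) ?nnegrE ?normc_ge0 // real_normK ?num_real //.
by rewrite normc_sqr lerDr sqr_ge0.
Qed.

Lemma normc_le_ReIm z : normc z <= `|Re z| + `|Im z|.
Proof.
rewrite -(ler_pXn2r (n := 2)) ?nnegrE ?normc_ge0 ?addr_ge0 // normc_sqr.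
rewrite sqrrD !real_normK ?num_real //.
by rewrite lerD2r lerDl mulrn_wge0 // mulr_ge0.
Qed.

Lemma normc_real (x : R) : normc x%:C = `|x|.
Proof. by rewrite /= expr0n addr0 sqrtr_sqr. Qed.

Lemma normc_conj z : normc z^* = normc z.
Proof. by case: z => a b /=; rewrite sqrrN. Qed.

Lemma normc_i : normc 'i = 1.
Proof. by rewrite /= expr0n expr1n add0r sqrtr1. Qed.

Lemma normcB_sym z w : normc (z - w) = normc (w - z).
Proof. by rewrite -normcN opprB. Qed.

Lemma cpcont_cst c : cpcont (fun=> c).
Proof. by split; exact: pcont_cst. Qed.

Lemma cpcont_real (u : R -> R) : pcont u -> cpcont (fun y => (u y)%:C).
Proof. by move=> pu; split => //; exact: pcont_cst. Qed.

Lemma cpcontD f g : cpcont f -> cpcont g -> cpcont (fun y => f y + g y).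
Proof.
move=> [f1 f2] [g1 g2]; split.
- by under eq_fun do rewrite complex_ReD; exact: pcontD.
- by under eq_fun do rewrite complex_ImD; exact: pcontD.
Qed.

Lemma cpcontN f : cpcont f -> cpcont (fun y => - f y).
Proof.
move=> [f1 f2]; split.
- by under eq_fun do rewrite complex_ReN; exact: pcontN.
- by under eq_fun do rewrite complex_ImN; exact: pcontN.
Qed.

Lemma cpcontB f g : cpcont f -> cpcont g -> cpcont (fun y => f y - g y).
Proof. by move=> cf cg; apply: cpcontD => //; exact: cpcontN. Qed.

Lemma cpcontM f g : cpcont f -> cpcont g -> cpcont (fun y => f y * g y).
Proof.
move=> [f1 f2] [g1 g2]; split.
- by under eq_fun do rewrite complex_ReM; apply: pcontB; exact: pcontM.
- by under eq_fun do rewrite complex_ImM; apply: pcontD; exact: pcontM.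
Qed.

Lemma cpcontZ c f : cpcont f -> cpcont (fun y => c * f y).
Proof. by apply: cpcontM; exact: cpcont_cst. Qed.

Lemma cpcont_bounded f : cpcont f -> exists2 B, 0 < B & forall y, normc (f y) <= B.
Proof.
move=> [/pcont_bounded[B1 B10 H1] /pcont_bounded[B2 B20 H2]].
exists (B1 + B2); first exact: addr_gt0.
by move=> y; rewrite (le_trans (normc_le_ReIm _)) // lerD.
Qed.

Lemma has_deriv_ext (F G p q : R -> R) : has_deriv F p -> F =1 G -> p =1 q ->
  has_deriv G q.
Proof. by move=> d /funext E /funext E'; rewrite -E -E'. Qed.

Lemma chas_deriv_ext f f' g g' : chas_deriv f f' -> f =1 g -> f' =1 g' ->
  chas_deriv g g'.
Proof. by move=> d /funext E /funext E'; rewrite -E -E'. Qed.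

Lemma chas_derivD f f' g g' : chas_deriv f f' -> chas_deriv g g' ->
  chas_deriv (fun y => f y + g y) (fun y => f' y + g' y).
Proof.
move=> [f1 f2] [g1 g2]; split.
- by apply: has_deriv_ext (has_derivD f1 g1) _ _ => y; rewrite complex_ReD.
- by apply: has_deriv_ext (has_derivD f2 g2) _ _ => y; rewrite complex_ImD.
Qed.

Lemma chas_derivM f f' g g' : chas_deriv f f' -> chas_deriv g g' ->
  chas_deriv (fun y => f y * g y) (fun y => f y * g' y + f' y * g y).
Proof.
move=> [f1 f2] [g1 g2]; split.
- apply: has_deriv_ext (has_derivB (has_derivM f1 g1) (has_derivM f2 g2)) _ _ => y;
    by rewrite !ReImE; ring.
- apply: has_deriv_ext (has_derivD (has_derivM f1 g2) (has_derivM f2 g1)) _ _ => y;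
    by rewrite !ReImE; ring.
Qed.

Lemma chas_deriv_cst c : chas_deriv (fun=> c) (fun=> 0).
Proof. by split; exact: has_deriv_cst. Qed.

Lemma chas_derivZ c f f' : chas_deriv f f' ->
  chas_deriv (fun y => c * f y) (fun y => c * f' y).
Proof.
move=> df; apply: chas_deriv_ext (chas_derivM (chas_deriv_cst c) df) _ _ => // y.
by rewrite mul0r addr0.
Qed.

Lemma chas_derivB f f' g g' : chas_deriv f f' -> chas_deriv g g' ->
  chas_deriv (fun y => f y - g y) (fun y => f' y - g' y).
Proof.
move=> df dg; apply: chas_deriv_ext (chas_derivD df (chas_derivZ (-1) dg)) _ _ => y;
  by rewrite mulN1r.
Qed.

Lemma chas_deriv_eq f g h : chas_deriv f g -> g =1 h -> chas_deriv f h.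
Proof. by move=> df /funext E; rewrite -E. Qed.

Lemma chas_deriv_real (F u : R -> R) : has_deriv F u ->
  chas_deriv (fun y => (F y)%:C) (fun y => (u y)%:C).
Proof. by move=> d; split => //; exact: has_deriv_cst. Qed.

Lemma cintegral_cst c : cintegral (fun=> c) = per%:C * c.
Proof.
rewrite /cintegral !Int_cst; apply: complex_eqP; rewrite !ReImE /=.
  by rewrite mul0r subr0.
by rewrite mul0r addr0.
Qed.

Lemma cintegralD f g : cpcont f -> cpcont g ->
  cintegral (fun y => f y + g y) = cintegral f + cintegral g.
Proof.
move=> [[_ f1] [_ f2]] [[_ g1] [_ g2]]; apply: complex_eqP; rewrite !ReImE /=.
- by rewrite -IntD //; congr Rintegral; apply/funext => y; rewrite complex_ReD.
- by rewrite -IntD //; congr Rintegral; apply/funext => y; rewrite complex_ImD.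
Qed.

Lemma cintegralZ c f : cpcont f -> cintegral (fun y => c * f y) = c * cintegral f.
Proof.
move=> [[_ f1] [_ f2]].
have cZ (x : R) u : continuous u -> continuous (fun y => x * u y).
  by move=> cu; apply: continuousM_fun => // ?; exact: cst_continuous.
apply: complex_eqP; rewrite !ReImE /=.
- rewrite -!IntZ // -IntB; [|exact: cZ|exact: cZ].
  by congr Rintegral; apply/funext => y; rewrite complex_ReM.
- rewrite -!IntZ // -IntD; [|exact: cZ|exact: cZ].
  by congr Rintegral; apply/funext => y; rewrite complex_ImM.
Qed.

Lemma cintegralN f : cpcont f -> cintegral (fun y => - f y) = - cintegral f.
Proof.
by move=> cf; rewrite -mulN1r -cintegralZ //; under eq_fun do rewrite -mulN1r.
Qed.

Lemma cintegralB f g : cpcont f -> cpcont g ->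
  cintegral (fun y => f y - g y) = cintegral f - cintegral g.
Proof. by move=> cf cg; rewrite cintegralD ?cintegralN //; exact: cpcontN. Qed.

Lemma cintegral_norm_le f B : cpcont f -> (forall y, normc (f y) <= B) ->
  normc (cintegral f) <= 2 * per * B.
Proof.
move=> [[_ f1] [_ f2]] fB; apply: le_trans (normc_le_ReIm _) _.
rewrite -mulrA mulr_natl mulr2n; apply: lerD; apply: Int_norm_le => // y.
- exact: le_trans (normRe_le _) (fB y).
- exact: le_trans (normIm_le _) (fB y).
Qed.

Lemma cintegral_deriv f f' : chas_deriv f f' -> cpcont f -> cpcont f' ->
  cintegral f' = 0.
Proof.
move=> [d1 d2] [[p1 _] [p2 _]] [[_ c1] [_ c2]].
by rewrite /cintegral (Int_deriv d1) // (Int_deriv d2).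
Qed.

Lemma cpcont_primitive k : cpcont k -> cintegral k = 0 ->
  exists v, [/\ chas_deriv v k, cpcont v & cintegral v = 0].
Proof.
move=> [k1 k2] [I1 I2].
have [p [dp pp Ip]] := pcont_primitive k1 I1.
have [q [dq pq Iq]] := pcont_primitive k2 I2.
exists (fun y => p y +i* q y); split; [by split|by split|].
by rewrite /cintegral /= Ip Iq.
Qed.

Lemma cpcont_uniform_limit f :
  (forall e : R, 0 < e -> exists2 g, cpcont g & forall y, normc (f y - g y) <= e) ->
  cpcont f.
Proof.
move=> H; split; apply: pcont_uniform_limit => e e0; have [g [g1 g2] fg] := H e e0.
- by exists (fun y => Re (g y)) => // y; rewrite -complex_ReN -complex_ReD (le_trans (normRe_le _)).
- by exists (fun y => Im (g y)) => // y; rewrite -complex_ImN -complex_ImD (le_trans (normIm_le _)).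
Qed.

(** Banach's theorem in the sup norm, with the complete space replaced by a predicate [A] stable
    under uniform limits. The iterates converge pointwise at a geometric rate independent of the
    point, hence uniformly; the factor 4 in the rate adds 2 for the real and 2 for the imaginary
    part. *)
Lemma ccontraction (A : (R -> R[i]) -> Prop) (F : (R -> R[i]) -> R -> R[i]) f0 :
  A f0 -> (forall f, A f -> A (F f)) ->
  (forall f, (forall e : R, 0 < e -> exists2 g, A g & forall y, normc (f y - g y) <= e) -> A f) ->
  (exists m : R, forall y, normc (F f0 y - f0 y) <= m) ->
  (forall f g (m : R), A f -> A g -> (forall y, normc (f y - g y) <= m) ->
     forall y, normc (F f y - F g y) <= m / 2) ->
  exists2 f, A f & F f = f.
Proof.
move=> A0 AF Acl [m m0] Flip.
pose s n := iter n F f0.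
have As n : A (s n) by elim: n => //= n; exact: AF.
have sS n y : normc (s n.+1 y - s n y) <= m / 2 ^+ n.
  elim: n y => [|n IH] y; first by rewrite expr0 divr1 m0.
  by rewrite exprSr invfM mulrA; exact: (Flip (s n.+1) (s n)).
have limRe y : exists l : R, forall n, `|Re (s n y) - l| <= 2 * m / 2 ^+ n.
  by apply: geometric_limit => n; rewrite -complex_ReN -complex_ReD (le_trans (normRe_le _)).
have [p pP] := choice limRe.
have limIm y : exists l : R, forall n, `|Im (s n y) - l| <= 2 * m / 2 ^+ n.
  by apply: geometric_limit => n; rewrite -complex_ImN -complex_ImD (le_trans (normIm_le _)).
have [q qP] := choice limIm.
pose f y := p y +i* q y.
have fs n y : normc (f y - s n y) <= 4 * m / 2 ^+ n.
  rewrite normcB_sym (le_trans (normc_le_ReIm _)) // !ReImE /=.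
  by apply: le_trans (lerD (pP y n) (qP y n)) _; lra.
have m_ge0 : 0 <= m by exact: le_trans (normc_ge0 _) (m0 0).
have small (e : R) : 0 < e -> exists n, 4 * m / 2 ^+ n <= e.
  move=> e0; have m1 : 0 < 4 * m + 1 by rewrite ltr_wpDl // mulr_ge0.
  have [n _ Hn] := near_infty_natSinv_expn_lt (PosNum (divr_gt0 e0 m1)).
  exists n; have /= := ltW (Hn n (leqnn n)).
  rewrite div1r ler_pdivlMr // => Hn'; apply: le_trans Hn'; rewrite [leRHS]mulrC.
  by rewrite ler_wpM2r ?invr_ge0 ?exprn_ge0 // lerDl.
have Af : A f.
  by apply: Acl => e e0; have [n ne] := small e e0; exists (s n) => // y;
     rewrite (le_trans (fs n y)).
exists f => //; apply/funext => y.
apply/eqP; rewrite -subr_eq0; apply/eqP/Normc.eq0_normc/eqP.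
rewrite eq_le normc_ge0 andbT; apply/ler_addgt0Pr => e e0; rewrite add0r.
have e2 : 0 < e / 2 by rewrite divr_gt0.
have [n ne] := small _ e2.
rewrite -(subrKA (F (s n) y)).
apply: le_trans (le_normcD _ _) _.
have h1 := Flip f (s n) _ Af (As n) (fs n) y.
have h2 := fs n.+1 y; rewrite normcB_sym in h2.
have : 4 * m / 2 ^+ n.+1 <= 4 * m / 2 ^+ n.
  by rewrite exprSr invfM mulrA ler_pdivrMr // ler_peMr ?ler1n // !mulr_ge0 // invr_ge0 exprn_ge0.
move: h1 h2; rewrite /s /= -/(s n); have := normc_ge0 (F f y - F (s n) y); lra.
Qed.

End ComplexFunctions.

(** * The equation v'' - z v = k on mean-zero functions *)

Section LinearProblem.
Context (R : realType).
Implicit Types (a b x y : R) (u : R -> R) (z w c : R[i]) (f g h k v : R -> R[i]).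
Local Notation mu := (@lebesgue_measure R).
Local Notation per := (pi *+ 2 : R).
Local Notation Int f := (\int[mu]_(y in circle) f y).

Local Notation normc := (@Normc.normc R).
Local Notation Re := (@complex.Re R).
Local Notation Im := (@complex.Im R).

(** A classical periodic solution of v'' - z v = k. The zero-mean normalisation makes the solution
    unique down to z = 0. *)
Definition sol z v k :=
  exists v1, [/\ chas_deriv v v1, chas_deriv v1 (fun y => z * v y + k y),
    cpcont v, cpcont v1 & cintegral v = 0].

Lemma sol_cpcont z v k : sol z v k -> cpcont v.
Proof. by case=> ? []. Qed.

Lemma sol_mean0 z v k : sol z v k -> cintegral v = 0.
Proof. by case=> ? []. Qed.

Lemma sol_ext z v k k' : sol z v k -> k =1 k' -> sol z v k'.
Proof. by move=> h /funext E; rewrite -E. Qed.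

Lemma sol_shift z w v k : sol z v k -> sol w v (fun y => (z - w) * v y + k y).
Proof.
case=> v1 [d1 d2 c c1 m]; exists v1; split => //.
by apply: chas_deriv_eq d2 _ => y; ring.
Qed.

Lemma solB z v k v' k' : sol z v k -> sol z v' k' ->
  sol z (fun y => v y - v' y) (fun y => k y - k' y).
Proof.
case=> v1 [d1 d2 c c1 m] [v1' [d1' d2' c' c1' m']].
exists (fun y => v1 y - v1' y); split.
- exact: chas_derivB.
- by apply: chas_deriv_eq (chas_derivB d2 d2') _ => y; ring.
- exact: cpcontB.
- exact: cpcontB.
- by rewrite cintegralB // m m' subrr.
Qed.

Lemma solZ z c v k : sol z v k -> sol z (fun y => c * v y) (fun y => c * k y).
Proof.
case=> v1 [d1 d2 cv c1 m]; exists (fun y => c * v1 y); split.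
- exact: chas_derivZ.
- by apply: chas_deriv_eq (chas_derivZ c d2) _ => y; ring.
- exact: cpcontZ.
- exact: cpcontZ.
- by rewrite cintegralZ // m mulr0.
Qed.

(** Twice the constant 2 per^2 that remains in [sol_bound] before absorption. *)
Definition Kper : R := 4 * per ^+ 2.

Lemma Kper_gt0 : 0 < Kper.
Proof. by rewrite mulr_gt0 // exprn_gt0 // per_gt0. Qed.

(** Energy estimate: the real part of the equation paired with the conjugate of [v] gives int |v'|^2
    = - Re z int |v|^2 - Re int conj(v) k. If |v| <= m this is at most per m a, and [oscillation]
    turns it back into a pointwise bound on [v]. Only the sign of Re z enters. *)
Lemma sol_bound z v k a : 0 <= Re z -> sol z v k -> cpcont k ->
  (forall y, normc (k y) <= a) -> forall y, normc (v y) <= Kper * a.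
Proof.
move=> z0 [v1 [[dp dq] [dp1 dq1] cv cv1 [Ip Iq]]] ck ka.
have [[pp _] [pq _]] := cv; have [[pp1 _] [pq1 _]] := cv1.
have a0 : 0 <= a by exact: le_trans (normc_ge0 _) (ka 0).
pose p y := Re (v y); pose q y := Im (v y).
pose p1 y := Re (v1 y); pose q1 y := Im (v1 y).
pose D y := p1 y * p1 y + q1 y * q1 y.
pose r y := p y * Re (k y) + q y * Im (k y).
pose W y := Re z * (p y * p y + q y * q y) + r y.
have cp : continuous p by case: cv => -[].
have cq : continuous q by case: cv => _ [].
have cp1 : continuous p1 by case: cv1 => -[].
have cq1 : continuous q1 by case: cv1 => _ [].
have cD : continuous D by apply: continuousD_fun; exact: continuousM_fun.
have cr : continuous r.
  by case: ck => -[_ ck1] [_ ck2]; apply: continuousD_fun; exact: continuousM_fun.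
have cpq : continuous (fun y => Re z * (p y * p y + q y * q y)).
  apply: continuousM_fun; first by move=> ?; exact: cst_continuous.
  by apply: continuousD_fun; exact: continuousM_fun.
have cW : continuous W by exact: continuousD_fun.
have IDW : Int D + Int W = 0.
  rewrite -IntD //.
  apply: (@Int_deriv _ (fun y => p y * p1 y + q y * q1 y)).
  - apply: has_deriv_eq (has_derivD (has_derivM dp dp1) (has_derivM dq dq1)) _ => y.
    by rewrite /D /W /r /p /q /p1 /q1 !ReImE; ring.
  - exact: continuousD_fun.
  - by move=> y; rewrite /p /q /p1 /q1 pp pq pp1 pq1.
have rW m : (forall y, normc (v y) <= m) -> Int D <= per * (m * a).
  move=> vm; have -> : Int D = - Int W by apply/eqP; rewrite -addr_eq0 IDW.
  rewrite -IntN // -Int_cst; apply: Int_le => //.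
  - exact: continuousN_fun.
  - by move=> ?; exact: cst_continuous.
  move=> y; have : 0 <= Re z * (p y * p y + q y * q y).
    by rewrite mulr_ge0 // addr_ge0 // -expr2 sqr_ge0.
  have : `|r y| <= m * a.
    have -> : r y = Re ((v y)^* * k y).
      by rewrite /r /p /q; case: (v y) => ? ?; case: (k y) => ? ? /=; ring.
    rewrite (le_trans (normRe_le _)) // Normc.normcM normc_conj.
    by rewrite ler_pM // normc_ge0.
  by rewrite ler_norml /W; lra.
have -> : Kper * a = 2 * (2 * per ^+ 2 * a) by rewrite /Kper; ring.
apply: (@le_double_of_halving _ (fun y => normc (v y))).
- by move=> y; exact: normc_ge0.
- exact: cpcont_bounded.
- move=> m m0 vm y.
  have pi0 := per_gt0 R.
  (* With this [s] each oscillation bound is per^2 a + m/4, so real and imaginary parts add up to 2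
     per^2 a + m/2, ready for absorption. *)
  pose s := m / (2 * per).
  have s0 : 0 < s by rewrite divr_gt0 // mulr_gt0.
  have osc1 := @oscillation _ p p1 D s pp dp cD _ Ip s0.
  have osc2 := @oscillation _ q q1 D s pq dq cD _ Iq s0.
  have {}osc1 : `|p y| <= (Int D + per * s ^+ 2) / (2 * s).
    by apply: osc1 => x; rewrite expr2 lerDl -expr2 sqr_ge0.
  have {}osc2 : `|q y| <= (Int D + per * s ^+ 2) / (2 * s).
    by apply: osc2 => x; rewrite expr2 lerDr -expr2 sqr_ge0.
  apply: le_trans (normc_le_ReIm _) _; apply: le_trans (lerD osc1 osc2) _.
  have -> : 2 * per ^+ 2 * a + m / 2 =
      (per * (m * a) + per * s ^+ 2) / (2 * s) + (per * (m * a) + per * s ^+ 2) / (2 * s).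
    rewrite /s; move: (lt0r_neq0 m0) (lt0r_neq0 pi0).
    by generalize per => P m_neq0 P_neq0; field; rewrite P_neq0 m_neq0.
  have h : (Int D + per * s ^+ 2) / (2 * s) <= (per * (m * a) + per * s ^+ 2) / (2 * s).
    by apply: ler_wpM2r; [rewrite invr_ge0 mulr_ge0 // ltW|rewrite lerD2r; exact: rW].
  exact: (lerD h h).
- by rewrite mulr_ge0 // mulr_ge0 // exprn_ge0 // ltW // per_gt0.
Qed.

Lemma sol_unique z v v' k : 0 <= Re z -> sol z v k -> sol z v' k -> v = v'.
Proof.
move=> z0 s s'; apply/funext => y; apply/eqP; rewrite -subr_eq0; apply/eqP.
apply/Normc.eq0_normc/eqP; rewrite eq_le normc_ge0 andbT -[leRHS](mulr0 Kper).
apply: sol_bound z0 (sol_ext (solB s s') (_ : _ =1 fun=> 0)) _ _ y.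
- by move=> x; rewrite subrr.
- exact: cpcont_cst.
- by move=> x; rewrite Normc.normc0.
Qed.

Lemma sol0_exists k : cpcont k -> cintegral k = 0 -> exists v, sol 0 v k.
Proof.
move=> ck Ik; have [v1 [d1 c1 I1]] := cpcont_primitive ck Ik.
have [v [d c I]] := cpcont_primitive c1 I1.
by exists v, v1; split => //; apply: chas_deriv_eq d1 _ => y; rewrite mul0r add0r.
Qed.

Definition mean0 f := cpcont f /\ cintegral f = 0.

Lemma mean0_uniform_limit f :
  (forall e : R, 0 < e -> exists2 g, mean0 g & forall y, normc (f y - g y) <= e) ->
  mean0 f.
Proof.
move=> H; have cf : cpcont f.
  by apply: cpcont_uniform_limit => e /H[g [cg _] fg]; exists g.
split=> //; apply/Normc.eq0_normc/eqP; rewrite eq_le normc_ge0 andbT.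
have pi0 := per_gt0 R.
apply/ler_addgt0Pr => e e0; rewrite add0r.
have p2 : 0 < 2 * per by rewrite mulr_gt0.
have [g [cg Ig] fg] := H _ (divr_gt0 e0 p2).
rewrite -[cintegral f]subr0 -Ig -cintegralB //.
apply: le_trans (cintegral_norm_le (cpcontB cf cg) fg) _.
by rewrite mulrC divfK // gt_eqF.
Qed.

Lemma mean0D f g : mean0 f -> mean0 g -> mean0 (fun y => f y + g y).
Proof.
by move=> [cf If] [cg Ig]; split; [exact: cpcontD|rewrite cintegralD // If Ig addr0].
Qed.

Lemma mean0Z c f : mean0 f -> mean0 (fun y => c * f y).
Proof. by move=> [cf If]; split; [exact: cpcontZ|rewrite cintegralZ // If mulr0]. Qed.

Lemma mean0B f g : mean0 f -> mean0 g -> mean0 (fun y => f y - g y).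
Proof.
by move=> [cf If] [cg Ig]; split; [exact: cpcontB|rewrite cintegralB // If Ig subrr].
Qed.

Definition solvable z := forall k, mean0 k -> exists v, sol z v k.

(** A solution at z + w is a fixed point of f -> S(w f + k), where S solves the problem at [z]. The
    map contracts by Kper |w|, a factor that does not depend on [z]. *)
Lemma solvable_step z w : 0 <= Re z -> Kper * normc w <= 1 / 2 ->
  solvable z -> solvable (z + w).
Proof.
move=> z0 wK Sz k mk.
pose S f := xget (fun=> 0) [set v | sol z v f].
have SP f : mean0 f -> sol z (S f) f.
  by move=> /Sz[v sv]; exact: (@xgetPex _ (fun=> 0) [set v | sol z v f] (ex_intro _ v sv)).
have mS f : sol z (S f) f -> mean0 (S f).
  by move=> s; split; [exact: sol_cpcont s|exact: sol_mean0 s].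
pose G f y := w * f y + k y.
have mG f : mean0 f -> mean0 (G f) by move=> mf; apply: mean0D => //; exact: mean0Z.
have m00 : mean0 (fun=> 0) by split; [exact: cpcont_cst|rewrite cintegral_cst mulr0].
have [] := @ccontraction _ mean0 (fun f => S (G f)) (fun=> 0) m00.
- by move=> f mf; apply/mS/SP/mG.
- exact: mean0_uniform_limit.
- have [B _ HB] := cpcont_bounded (sol_cpcont (SP _ (mG _ m00))).
  by exists B => y; rewrite subr0.
- move=> f g m mf mg fg y.
  apply: le_trans (sol_bound z0 (solB (SP _ (mG _ mf)) (SP _ (mG _ mg))) _
    (a := normc w * m) _ y) _.
  + by apply: cpcontB; [case: (mG _ mf)|case: (mG _ mg)].
  + move=> x; rewrite /G (_ : _ - _ = w * (f x - g x)); last by ring.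
    by rewrite Normc.normcM ler_wpM2l // normc_ge0.
  + rewrite mulrA -[m / 2]mulrC -[2^-1]mul1r ler_wpM2r //.
    exact: le_trans (normc_ge0 _) (fg 0).
- move=> f mf Ff; exists f.
  have := SP _ (mG _ mf); rewrite Ff => s.
  by apply: sol_ext (sol_shift (z + w) s) _ => y; rewrite /G; ring.
Qed.

(** Method of continuity along the segment from 0 to [z]. At 0 the equation is integrated twice;
    since the admissible step length is uniform, [N] equal steps reach [z]. *)
Lemma sol_exists z k : 0 <= Re z -> mean0 k -> exists v, sol z v k.
Proof.
move=> z0; have K0 := Kper_gt0; move: k.
pose N := (Num.truncn (2 * (Kper * normc z))).+1.
have N0 : 0 < N%:R :> R by rewrite ltr0n.
have NE : Kper * normc ((N%:R^-1)%:C * z) <= 1 / 2.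
  rewrite Normc.normcM normc_real gtr0_norm ?invr_gt0 // mulrCA mulrC ler_pdivrMr //.
  by have := ltW (truncnS_gt (2 * (Kper * normc z))); rewrite -/N; lra.
have step n : solvable ((n%:R / N%:R)%:C * z).
  elim: n => [|n IH].
    by move=> k [ck Ik]; rewrite mul0r mul0r; exact: sol0_exists.
  have -> : ((n.+1%:R / N%:R)%:C * z : R[i]) = (n%:R / N%:R)%:C * z + (N%:R^-1)%:C * z.
    by rewrite -mulrDl -rmorphD /= -[in LHS]addn1 natrD mulrDl mul1r.
  apply: solvable_step => //.
  by rewrite !ReImE /= mul0r subr0 !mulr_ge0 // invr_ge0.
by have := step N; rewrite divff ?gt_eqF // mul1r.
Qed.

End LinearProblem.

(** * The nonlinear equation for the zero-mean part of the eigenfunction *)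

Section NonlinearProblem.
Context (R : realType).
Implicit Types (a b x y : R) (u : R -> R) (z w c : R[i]) (f g h k v : R -> R[i]).
Local Notation mu := (@lebesgue_measure R).
Local Notation per := (pi *+ 2 : R).
Local Notation Int f := (\int[mu]_(y in circle) f y).

Local Notation normc := (@Normc.normc R).
Local Notation Re := (@complex.Re R).
Local Notation Im := (@complex.Im R).

Local Notation Kper := (@Kper R).

Lemma normc_leD z w a b : normc z <= a -> normc w <= b -> normc (z + w) <= a + b.
Proof. by move=> za wb; apply: le_trans (le_normcD _ _) (lerD za wb). Qed.

Lemma normc_leB z w a b : normc z <= a -> normc w <= b -> normc (z - w) <= a + b.
Proof. by move=> za wb; apply: normc_leD => //; rewrite normcN. Qed.

Lemma normc_leM z w a b : normc z <= a -> normc w <= b -> normc (z * w) <= a * b.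
Proof. by move=> za wb; rewrite Normc.normcM ler_pM // normc_ge0. Qed.

Definition cmean f : R[i] := (per^-1)%:C * cintegral f.

Lemma cmean_norm_le f a : cpcont f -> (forall y, normc (f y) <= a) ->
  normc (cmean f) <= 2 * a.
Proof.
move=> cf fa; have pi0 := per_gt0 R.
rewrite Normc.normcM normc_real gtr0_norm ?invr_gt0 // mulrC ler_pdivrMr //.
by rewrite mulrAC; exact: cintegral_norm_le.
Qed.

Lemma cmeanD f g : cpcont f -> cpcont g ->
  cmean (fun y => f y + g y) = cmean f + cmean g.
Proof. by move=> cf cg; rewrite /cmean cintegralD // mulrDr. Qed.

Lemma cmeanB f g : cpcont f -> cpcont g ->
  cmean (fun y => f y - g y) = cmean f - cmean g.
Proof. by move=> cf cg; rewrite /cmean cintegralB // mulrBr. Qed.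

Lemma cmeanZ c f : cpcont f -> cmean (fun y => c * f y) = c * cmean f.
Proof. by move=> cf; rewrite /cmean cintegralZ // mulrCA. Qed.

Lemma cmean_cst c : cmean (fun=> c) = c.
Proof.
by rewrite /cmean cintegral_cst mulrA -rmorphM mulVf ?mul1r // lt0r_neq0 // per_gt0.
Qed.

Lemma cmean0P f : cmean f = 0 <-> cintegral f = 0.
Proof.
split=> [/eqP|I]; last by rewrite /cmean I mulr0.
rewrite mulf_eq0 => /orP[/eqP/complexI/eqP|/eqP//].
by rewrite invr_eq0 gt_eqF // per_gt0.
Qed.

Definition Sol z k := xget (fun=> 0) [set v | sol z v k].

Lemma SolP z k : 0 <= Re z -> mean0 k -> sol z (Sol z k) k.
Proof.
move=> z0 mk; have [v sv] := sol_exists z0 mk.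
exact: (@xgetPex _ (fun=> 0) [set v | sol z v k] (ex_intro _ v sv)).
Qed.

Lemma sol_mean0P z v k : sol z v k -> mean0 v.
Proof. by move=> s; split; [exact: sol_cpcont s|exact: sol_mean0 s]. Qed.

(** All that the analysis uses of the shear flow. [M] will be the C^2 norm, so constants built from
    [M] depend on the flow only through that norm. *)
Record profile (U U1 U2 : R -> R) (M : R) : Prop := Profile {
  profile_deriv : has_deriv U U1;
  profile_deriv1 : has_deriv U1 U2;
  profile_pcont : pcont U;
  profile_pcont1 : pcont U1;
  profile_pcont2 : pcont U2;
  profile_mean : Int U = 0;
  profile_bound : forall y, `|U y| <= M;
  profile_bound2 : forall y, `|U2 y| <= M }.

(** The terms of [Qform] add up to M + 7 M Kper + beta Kper. The surplus 4 M makes [Lam M] dominate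
    also the bound 2 M of [forcing]. *)
Definition Lam (M : R) : R := 5 * M + 7 * (M * Kper) + Kper.

Section Profile.
Context (U U1 U2 : R -> R) (M : R) (UP : profile U U1 U2 M).

Lemma M_ge0 : 0 <= M.
Proof. exact: le_trans (normr_ge0 _) (profile_bound UP 0). Qed.

Lemma cpcontU : cpcont (fun y => (U y)%:C).
Proof. by apply: cpcont_real; case: UP. Qed.

Lemma cpcontU2 : cpcont (fun y => (U2 y)%:C).
Proof. by apply: cpcont_real; case: UP. Qed.

Lemma mean0U : mean0 (fun y => (U y)%:C).
Proof.
split; first exact: cpcontU.
by rewrite /cintegral /= (profile_mean UP) Int_cst mulr0.
Qed.

Lemma mean0U2 : mean0 (fun y => (U2 y)%:C).
Proof.
split; first exact: cpcontU2.
apply: cintegral_deriv (chas_deriv_real (profile_deriv1 UP)) _ cpcontU2.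
exact: cpcont_real (profile_pcont1 UP).
Qed.

Definition Umean f := cmean (fun y => (U y)%:C * f y).

Lemma Umean_norm_le f a : cpcont f -> (forall y, normc (f y) <= a) ->
  normc (Umean f) <= 2 * M * a.
Proof.
move=> cf fa; rewrite -mulrA; apply: cmean_norm_le.
  exact: cpcontM cpcontU cf.
move=> y; apply: normc_leM => //; rewrite normc_real; exact: profile_bound UP y.
Qed.

Lemma UmeanB f g : cpcont f -> cpcont g ->
  Umean (fun y => f y - g y) = Umean f - Umean g.
Proof.
move=> cf cg; rewrite -cmeanB; [|exact: cpcontM cpcontU cf|exact: cpcontM cpcontU cg].
by congr cmean; apply/funext => y; rewrite mulrBr.
Qed.

Lemma UmeanZ c f : cpcont f -> Umean (fun y => c * f y) = c * Umean f.
Proof.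
move=> cf; rewrite -cmeanZ; last exact: cpcontM cpcontU cf.
by congr cmean; apply/funext => y; rewrite mulrCA.
Qed.

(* Two integrations by parts: <U e''> = <U'' e>. *)
Lemma Umean_helmholtz c e d : cpcont d -> sol c e d ->
  cmean (fun y => (U y)%:C * d y - (U2 y)%:C * e y + c * Umean e) = 0.
Proof.
move=> cd [e1 [de de1 ce ce1 _]].
have cUd := cpcontM cpcontU cd; have cUe := cpcontM cpcontU ce.
have cU2e := cpcontM cpcontU2 ce.
rewrite cmeanD; [|exact: cpcontB|exact: cpcont_cst].
rewrite cmean_cst -cmeanZ // -cmeanD; [|exact: cpcontB|exact: cpcontZ].
apply/cmean0P.
have dU := chas_deriv_real (profile_deriv UP).
have dU1 := chas_deriv_real (profile_deriv1 UP).
have cU1 := cpcont_real (profile_pcont1 UP).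
apply: (cintegral_deriv (f := fun y => (U y)%:C * e1 y - (U1 y)%:C * e y)).
- by apply: chas_deriv_eq (chas_derivB (chas_derivM dU de1) (chas_derivM dU1 de)) _ => y; ring.
- by apply: cpcontB; apply: cpcontM => //; exact: cpcontU.
- by apply: cpcontD; [exact: cpcontB|exact: cpcontZ].
Qed.

(** * Estimates and solution for small eta (1 + beta) *)

Section SmallForcing.
Context (eps beta eta b : R).
Context (eta0 : 0 < eta) (beta0 : 0 < beta).
Context (eps_small : eps ^+ 2 <= eta * (1 + beta)).
Context (eta_small : eta * (1 + beta) <= 1).
Context (eta_Lam : Kper * (eta * (1 + beta) * Lam M) <= 1 / 2).

(* Polarised: [rhs] takes [t h] as its quadratic term, while differences and
   derivatives of [rhs] also produce [s d]. *)
Definition Qform d e (t : R[i]) h (s : R[i]) y : R[i] :=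
  (U y)%:C * d y - (U2 y)%:C * e y + (eps ^+ 2)%:C * t + beta%:C * e y
  - t * h y - s * d y.

Definition forcing y : R[i] := (eps ^+ 2 * U y + U2 y)%:C.

(** The right-hand side of the equation for h, with [e] for phi. The two are tied only by the
    hypothesis [sol eps2 e h], so differences of [rhs] reduce to ring identities. *)
Definition rhs h e y : R[i] :=
  'i * eta%:C * (Qform h e (Umean e) h 0 y - forcing y).

Let eps2 : R[i] := (eps ^+ 2)%:C.
Let ib : R[i] := 'i * b%:C.

Lemma Re_eps2_ge0 : 0 <= Re eps2.
Proof. exact: sqr_ge0. Qed.

Lemma Re_ib_ge0 : 0 <= Re ib.
Proof. by rewrite /ib /= mul0r mulr0 subr0. Qed.

(** The constant eps^2 <U, e> is exactly what compensates the mean of U d - U'' e, by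
    [Umean_helmholtz]; the other terms are multiples of mean-free functions. *)
Lemma mean0_Qform d e h s : sol eps2 e d -> mean0 d -> mean0 h ->
  mean0 (Qform d e (Umean e) h s).
Proof.
move=> se md mh; have me := sol_mean0P se.
apply: mean0B (mean0B (mean0D _ (mean0Z _ me)) (mean0Z _ mh)) (mean0Z _ md).
split; last by apply/cmean0P; apply: Umean_helmholtz => //; case: md.
apply: cpcontD; last exact: cpcont_cst.
by apply: cpcontB; apply: cpcontM; [exact: cpcontU|case: md|exact: cpcontU2|case: me].
Qed.

Lemma mean0_forcing : mean0 forcing.
Proof.
have := mean0D (mean0Z eps2 mean0U) mean0U2; congr mean0; apply/funext => y.
by rewrite /forcing rmorphD rmorphM.
Qed.

Lemma mean0_rhs h e : sol eps2 e h -> mean0 h -> mean0 (rhs h e).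
Proof.
by move=> se mh; apply: mean0Z; apply: mean0B mean0_forcing; exact: mean0_Qform.
Qed.

(** One estimate for three uses: the size of [rhs] (s = 0), its Lipschitz constant, and its
    linearisation. It is linear in [m]; the assumed bound on [s] is the one that <U, e> inherits
    from a source of size at most 1. *)
Lemma Qform_norm_le d e t h s m : 0 <= m ->
  (forall y, normc (d y) <= m) -> (forall y, normc (e y) <= Kper * m) ->
  normc t <= 2 * M * (Kper * m) -> (forall y, normc (h y) <= 1) ->
  normc s <= 2 * M * (Kper * 1) ->
  forall y, normc (Qform d e t h s y) <= (1 + beta) * Lam M * m.
Proof.
move=> m0 dm em tm h1 s1 y; have K0 := (Kper_gt0 R); have M0 := M_ge0.
have HU : normc (U y)%:C <= M by rewrite normc_real; exact: profile_bound UP y.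
have HU2 : normc (U2 y)%:C <= M by rewrite normc_real; exact: profile_bound2 UP y.
have He : normc (eps ^+ 2)%:C <= 1.
  by rewrite normc_real ger0_norm ?sqr_ge0 // (le_trans eps_small).
have Hb : normc beta%:C <= beta by rewrite normc_real gtr0_norm.
apply: le_trans (normc_leB (normc_leB (normc_leD (normc_leD (normc_leB
  (normc_leM HU (dm y)) (normc_leM HU2 (em y))) (normc_leM He tm))
  (normc_leM Hb (em y))) (normc_leM tm (h1 y))) (normc_leM s1 (dm y))) _.
rewrite /Lam -subr_ge0.
have -> : (1 + beta) * (5 * M + 7 * (M * Kper) + Kper) * m -
  (M * m + M * (Kper * m) + 1 * (2 * M * (Kper * m)) + beta * (Kper * m) +
   2 * M * (Kper * m) * 1 + 2 * M * (Kper * 1) * m) =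
  m * (4 * M + Kper + beta * (5 * M + 7 * (M * Kper))) by ring.
by nonneg.
Qed.

Lemma forcing_norm_le y : normc (forcing y) <= 2 * M.
Proof.
rewrite /forcing rmorphD rmorphM -[2]/(1 + 1) mulrDl mul1r.
apply: normc_leD; last by rewrite normc_real; exact: profile_bound2 UP y.
rewrite -[leRHS]mul1r; apply: normc_leM; last by rewrite normc_real; exact: profile_bound UP y.
by rewrite normc_real ger0_norm ?sqr_ge0 // (le_trans eps_small).
Qed.

Lemma normc_ieta z a : normc z <= a -> normc ('i * eta%:C * z) <= eta * a.
Proof.
move=> za; rewrite !Normc.normcM normc_i mul1r normc_real gtr0_norm //.
by rewrite ler_wpM2l // ltW.
Qed.

Lemma sol_eps2_bound e d m : sol eps2 e d -> mean0 d ->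
  (forall y, normc (d y) <= m) ->
  (forall y, normc (e y) <= Kper * m) /\ normc (Umean e) <= 2 * M * (Kper * m).
Proof.
move=> se [cd _] dm; have eb := sol_bound Re_eps2_ge0 se cd dm.
by split=> //; apply: Umean_norm_le => //; exact: sol_cpcont se.
Qed.

Lemma rhs_norm_le h e m : sol eps2 e h -> mean0 h ->
  (forall y, normc (h y) <= 1) -> (forall y, normc (h y) <= m) ->
  forall y, normc (rhs h e y) <= eta * ((1 + beta) * Lam M * m + 2 * M).
Proof.
move=> se mh h1 hm y; apply: normc_ieta; apply: normc_leB; last exact: forcing_norm_le.
have [em tm] := sol_eps2_bound se mh hm.
apply: Qform_norm_le => //; first exact: le_trans (normc_ge0 _) (hm 0).
by rewrite Normc.normc0; have := M_ge0; have := Kper_gt0 R => ? ?; nonneg.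
Qed.

(** The quadratic part splits as t h - t' h' = (t - t') h + t' (h - h'), which accounts for the last
    two arguments of [Qform]. *)
Lemma rhsB h e h' e' y : cpcont e -> cpcont e' ->
  rhs h e y - rhs h' e' y =
  'i * eta%:C * Qform (fun x => h x - h' x) (fun x => e x - e' x)
     (Umean (fun x => e x - e' x)) h (Umean e') y.
Proof. by move=> ce ce'; rewrite UmeanB // /rhs /Qform; ring. Qed.

(** Fixed point on the mean-free functions of the unit ball: solve the Helmholtz problem for [e],
    insert it into [rhs], and solve the problem with parameter [ib]. The smallness condition gives
    1/2 for the Lipschitz part and 1/2 for the forcing, so the ball is preserved. *)
Lemma nonlinear_solution : exists h e, [/\ sol eps2 e h, sol ib h (rhs h e) &
  forall y, normc (h y) <= 1].
Proof.
have K0 := (Kper_gt0 R); have M0 := M_ge0.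
pose A h := mean0 h /\ forall y, normc (h y) <= 1.
pose S h := Sol eps2 h.
have SP h : A h -> sol eps2 (S h) h.
  by case=> mh _; apply: SolP => //; exact: Re_eps2_ge0.
pose F h := Sol ib (rhs h (S h)).
have mr h : A h -> mean0 (rhs h (S h)).
  by move=> Ah; apply: mean0_rhs; [exact: SP|case: Ah].
have FP h : A h -> sol ib (F h) (rhs h (S h)).
  by move=> Ah; apply: SolP; [exact: Re_ib_ge0|exact: mr].
(* The forcing alone contributes at most one half, because [Lam M] dominates 2 M. *)
have etaM : Kper * (eta * (2 * M)) <= 1 / 2.
  apply: le_trans eta_Lam; apply: ler_wpM2l; first exact: ltW.
  rewrite -mulrA; apply: ler_wpM2l; first exact: ltW.
  rewrite /Lam -subr_ge0.
  have -> : (1 + beta) * (5 * M + 7 * (M * Kper) + Kper) - 2 * M =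
    3 * M + 7 * (M * Kper) + Kper + beta * (5 * M + 7 * (M * Kper) + Kper) by ring.
  by nonneg.
have A0 : A (fun=> 0).
  split; last by move=> y; rewrite Normc.normc0.
  by split; [exact: cpcont_cst|rewrite cintegral_cst mulr0].
have AF h : A h -> A (F h).
  move=> Ah; have [mh h1] := Ah; split; first exact: sol_mean0P (FP _ Ah).
  move=> y; have [cr _] := mr h Ah.
  apply: le_trans (sol_bound Re_ib_ge0 (FP _ Ah) cr (rhs_norm_le (SP _ Ah) mh h1 h1) y) _.
  by move: eta_Lam etaM; lra.
have [h Ah Fh] : exists2 h, A h & F h = h.
  apply: (ccontraction A0 AF).
  - move=> f H; split; first by apply: mean0_uniform_limit => e /H[g [mg _] fg]; exists g.
    move=> y; apply/ler_addgt0Pr => e /H[g [_ g1] fg].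
    by rewrite -(subrK (g y) (f y)) addrC [1 + e]addrC [e + 1]addrC; exact: normc_leD.
  - by exists 1 => y; rewrite subr0; case: (AF _ A0).
  - move=> f g m Af Ag fg y.
    have [mf f1] := Af; have [mg g1] := Ag.
    have mfg := mean0B mf mg.
    have sS := solB (SP _ Af) (SP _ Ag).
    have [em tm] := sol_eps2_bound sS mfg fg.
    have [_ sg] := sol_eps2_bound (SP _ Ag) mg g1.
    have cSf := sol_cpcont (SP _ Af); have cSg := sol_cpcont (SP _ Ag).
    have m0 : 0 <= m by exact: le_trans (normc_ge0 _) (fg 0).
    apply: le_trans (sol_bound Re_ib_ge0 (solB (FP _ Af) (FP _ Ag)) _
      (a := eta * ((1 + beta) * Lam M * m)) _ y) _.
    + by apply: cpcontB; [case: (mr _ Af)|case: (mr _ Ag)].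
    + by move=> x; rewrite rhsB //; apply: normc_ieta; exact: Qform_norm_le.
    + rewrite [m / 2]mulrC -[2^-1]mul1r; have := ler_wpM2r m0 eta_Lam.
      by rewrite !mulrA.
exists h, (S h); split; [exact: SP|by rewrite -{1}Fh; exact: FP|by case: Ah].
Qed.

(** The equation, read once more, improves the bound 1 to order eta: |h| <= m implies |h| <= 2 M
    Kper eta + m/2. *)
Lemma nonlinear_solution_bound h e : sol eps2 e h -> sol ib h (rhs h e) ->
  (forall y, normc (h y) <= 1) -> forall y, normc (h y) <= 4 * (M * Kper * eta).
Proof.
move=> se sh h1; have K0 := (Kper_gt0 R); have M0 := M_ge0.
have mh := sol_mean0P sh; have [ch _] := mh.
have [cr _] := mean0_rhs se mh.
have -> : 4 * (M * Kper * eta) = 2 * (2 * (M * Kper * eta)) by ring.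
apply: (@le_double_of_halving _ (fun y => normc (h y))).
- by move=> y; exact: normc_ge0.
- exact: cpcont_bounded.
- move=> m m0 hm y.
  apply: le_trans (sol_bound Re_ib_ge0 sh cr (rhs_norm_le se mh h1 hm) y) _.
  have := ler_wpM2r (ltW m0) eta_Lam; lra.
- by nonneg.
Qed.

(** From the inside out: the source error for h, the bound [Kper] for h, the error from eps^2 v, the
    bound [Kper] for e, and the pairing with U. *)
Definition ConstC : R := 2 * M * (Kper * (Kper * (M + 4 * (Lam M * M * Kper)) + M * Kper)).

(** Two comparisons. First h is compared with -i eta v'', whose equation has the source -i eta U'';
    what is left of [rhs] has order eta^2 (1 + beta), since h = O(eta) and eps^2 <= eta (1 + beta).
    Then e is compared with -i eta v through the Helmholtz equation. *)
Lemma leading_order h e v : sol eps2 e h -> sol ib h (rhs h e) ->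
  (forall y, normc (h y) <= 1) -> sol ib v (fun y => (U y)%:C) ->
  normc (Umean e - - ('i * eta%:C) * Umean v) <= ConstC * (eta ^+ 2 * (1 + beta)).
Proof.
move=> se sh h1 sv; have K0 := (Kper_gt0 R); have M0 := M_ge0.
have mh := sol_mean0P sh; have hb := nonlinear_solution_bound se sh h1.
have mv := sol_mean0P sv; have [cv _] := mv.
(* This is v''. It solves the same equation as [v], with source U'' instead of U. *)
pose w y : R[i] := ib * v y + (U y)%:C.
have mw : mean0 w by apply: mean0D mean0U; exact: mean0Z.
have vb := sol_bound Re_ib_ge0 sv cpcontU
  (fun y => eq_rect_r (fun t => t <= M) (profile_bound UP y) (normc_real (U y))).
have [v1 [dv dv1 _ cv1 _]] := sv.
have sw : sol ib w (fun y => (U2 y)%:C).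
  exists (fun y => ib * v1 y + (U1 y)%:C); split.
  - by apply: chas_derivD (chas_derivZ _ dv) (chas_deriv_real (profile_deriv UP)).
  - apply: chas_deriv_eq (chas_derivD (chas_derivZ ib dv1)
      (chas_deriv_real (profile_deriv1 UP))) _ => y.
    by rewrite /w.
  - by case: mw.
  - by apply: cpcontD; [exact: cpcontZ|exact: cpcont_real (profile_pcont1 UP)].
  - by case: mw.
have s0v : sol 0 v w.
  by exists v1; split => //; [apply: chas_deriv_eq dv1 _ => y; rewrite mul0r add0r|case: mv].
have seh := solB se (solZ (- ('i * eta%:C)) (sol_shift eps2 s0v)).
have shw := solB sh (solZ (- ('i * eta%:C)) sw).
have [cr _] := mean0_rhs se mh.
have hw : forall y, normc (h y - - ('i * eta%:C) * w y) <=
    Kper * ((M + 4 * (Lam M * M * Kper)) * (eta ^+ 2 * (1 + beta))).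
  apply: sol_bound Re_ib_ge0 shw _ _.
    by apply: cpcontB cr _; exact: cpcontZ cpcontU2.
  move=> y; have -> : rhs h e y - - ('i * eta%:C) * (U2 y)%:C =
    'i * eta%:C * (Qform h e (Umean e) h 0 y - (eps ^+ 2)%:C * (U y)%:C).
    by rewrite /rhs /forcing rmorphD rmorphM /=; ring.
  have [em tm] := sol_eps2_bound se mh hb.
  have Q := @Qform_norm_le h e (Umean e) h 0 _ _ hb em tm h1 _ y.
  apply: le_trans (normc_ieta (normc_leB (Q _ _)
    (normc_leM (a := eta * (1 + beta)) (b := M) _ _))) _.
  - by nonneg.
  - by rewrite Normc.normc0; nonneg.
  - by rewrite normc_real ger0_norm // sqr_ge0.
  - by rewrite normc_real; exact: profile_bound UP y.
  - by rewrite le_eqVlt; apply/orP; left; apply/eqP; ring.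
have eb : forall y, normc (e y - - ('i * eta%:C) * v y) <=
    Kper * ((Kper * (M + 4 * (Lam M * M * Kper)) + M * Kper) * (eta ^+ 2 * (1 + beta))).
  apply: sol_bound Re_eps2_ge0 seh _ _.
    case: mh => ch _; apply: cpcontB ch (cpcontZ _ (cpcontD (cpcontZ _ cv) _)).
    by case: mw.
  move=> y; have -> : h y - - ('i * eta%:C) * ((0 - eps2) * v y + w y) =
     (h y - - ('i * eta%:C) * w y) - 'i * eta%:C * (eps2 * v y) by ring.
  apply: le_trans (normc_leB (hw y) (normc_ieta (normc_leM (a := eta * (1 + beta)) _ (vb y)))) _.
    by rewrite normc_real ger0_norm // sqr_ge0.
  by rewrite le_eqVlt; apply/orP; left; apply/eqP; ring.
have ce := sol_cpcont se.
rewrite -UmeanZ // -UmeanB //; last exact: cpcontZ.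
apply: le_trans (Umean_norm_le _ eb) _; first by apply: cpcontB ce _; exact: cpcontZ.
by rewrite le_eqVlt; apply/orP; left; apply/eqP; rewrite /ConstC; ring.
Qed.

(* [Qform d g (Umean g) h (Umean e)] is the derivative of
   [Qform h e (Umean e) h 0] in the direction [d]. *)
Lemma linearized_injective h e d g : sol eps2 e h -> sol ib h (rhs h e) ->
  (forall y, normc (h y) <= 1) -> sol eps2 g d ->
  sol ib d (fun y => 'i * eta%:C * Qform d g (Umean g) h (Umean e) y) ->
  d = fun=> 0.
Proof.
move=> se sh h1 sx sd; have K0 := (Kper_gt0 R); have M0 := M_ge0.
have mh := sol_mean0P sh; have md := sol_mean0P sd.
have [_ s1] := sol_eps2_bound se mh h1.
have cQ := mean0Z ('i * eta%:C) (mean0_Qform (Umean e) sx md mh).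
(* The linearised equation is homogeneous, so each bound can be halved with no remainder. *)
have d0 : forall y, normc (d y) <= 2 * 0.
  apply: (@le_double_of_halving _ (fun y => normc (d y))) => //.
  - by move=> y; exact: normc_ge0.
  - by case: md => cd _; exact: cpcont_bounded.
  - move=> m m0 dm y; rewrite add0r.
    have [em tm] := sol_eps2_bound sx md dm.
    have [cQ' _] := cQ.
    apply: le_trans (sol_bound Re_ib_ge0 sd cQ' _ (a := eta * ((1 + beta) * Lam M * m)) y) _.
      by move=> z; apply: normc_ieta; apply: Qform_norm_le => //; exact: ltW.
    have := ler_wpM2r (ltW m0) eta_Lam; lra.
apply/funext => y; apply/Normc.eq0_normc/eqP.
by rewrite eq_le normc_ge0 andbT; have := d0 y; rewrite mulr0.
Qed.

End SmallForcing.
End Profile.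

End NonlinearProblem.

(** * Weak derivatives and their regularity *)

Section Primitives.
Context (R : realType).

Local Notation mu := (@lebesgue_measure R).
Local Notation per := (pi *+ 2 : R).
Local Notation Int f := (\int[mu]_(y in circle) f y).

Local Notation normc := (@Normc.normc R).
Local Notation Re := (@complex.Re R).
Local Notation Im := (@complex.Im R).

Implicit Types (a b c x y z : R) (p q r phi : R -> R).

(** [E] translates the point back to the fundamental domain. The jumps of the floor function do no
    harm because [r] vanishes at both ends. *)
Lemma periodic_extension r : continuous r ->
  (forall y, y <= 0 -> r y = 0) -> (forall y, per <= y -> r y = 0) ->
  exists2 E, pcont E & forall y, circle y -> E y = r y.
Proof.
move=> cr rl rr; have p0 := per_gt0 R; have pn0 := lt0r_neq0 p0.
pose E y := r (y - per * (Num.floor (y / per))%:~R).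
have EE y n : (n%:~R * per <= y < (n + 1)%:~R * per) -> E y = r (y - per * n%:~R).
  move=> /andP[h1 h2]; rewrite /E (@floor_def _ _ n) //.
  by rewrite ler_pdivlMr // ltr_pdivrMr // h1 h2.
exists E; last first.
  move=> y; rewrite /circle /= in_itv /= => /andP[y0]; rewrite le_eqVlt => /predU1P[->|y1].
    rewrite (EE _ 1) ?mulr1 ?subrr; last first.
      by rewrite !mulr1z intrD !mulr1z mul1r lexx /= mulrDl mul1r ltrDl.
    by rewrite rl // rr.
  by rewrite (EE _ 0) ?mulr0 ?subr0 // mul0r y0 add0r mul1r.
split=> y.
  have fl : Num.floor ((y + per) / per) = Num.floor (y / per) + 1.
    have /andP[nl nr] := floor_itv (y / per).
    apply: floor_def; rewrite !intrD !mulr1z mulrDl divff // lerD2r ltrD2r.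
    by rewrite nl; move: nr; rewrite intrD mulr1z.
  rewrite /E fl intrD mulr1z mulrDr mulr1; congr r; ring.
pose n := Num.floor (y / per).
have /andP[] := floor_itv (y / per); rewrite -/n intrD mulr1z => nl nr.
have {}nl : n%:~R * per <= y by rewrite -ler_pdivlMr.
have {}nr : y < (n%:~R + 1) * per by rewrite -ltr_pdivrMr.
(* Around [y], which may be a multiple of [per], only two adjacent translates can be nonzero; their
   sum is continuous and equals [E] there. *)
pose E' z := r (z - per * n%:~R) + r (z - per * (n%:~R - 1)).
have cE' : continuous E'.
  have crs c : continuous (fun z => r (z - c)).
    move=> z; apply: (@continuous_comp _ _ _ (fun z => z - c) r); last exact: cr.
    by apply: continuousB => //; exact: cst_continuous.
  exact: continuousD_fun.
have near_E : \near y, E' y = E y.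
  near=> z.
  have z1 : (n%:~R - 1) * per < z.
    near: z; apply: lt_nbhsr; apply: lt_le_trans nl.
    by rewrite ltr_pM2r // ltrBlDr ltrDl.
  have z2 : z < (n%:~R + 1) * per by near: z; apply: lt_nbhsl.
  have [zn|zn] := leP (n%:~R * per) z.
    rewrite (EE _ n) ?zn /E' ?intrD ?mulr1z //.
    by rewrite [X in _ + X]rr ?addr0 //; rewrite mulrDr mulrN mulr1; move: zn; lra.
  rewrite (EE _ (n - 1)) ?subrK /E' ?intrB ?mulr1z ?zn ?ltW //.
  by rewrite rl ?add0r // subr_le0 mulrC ltW.
have EEy : E' y = E y by exact: nbhs_singleton near_E.
rewrite /continuous_at -EEy.
exact: (cvg_trans (near_eq_cvg near_E) (cE' y)).
Unshelve. all: by end_near. Qed.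

Definition cinteg r := mu.-integrable circle (EFin \o r).

(** The upper limit is encoded as a factor of the integrand, the form in which Fubini applies in
    [parts]. *)
Definition prim r y := Int (fun t => r t * (t <= y)%R%:R).

(** Starting the integral at -1 makes 0 an interior point, so that continuity and differentiation
    results cover the whole circle. *)
Lemma primE r y : prim r y = \int[mu]_(t in `[-1, y]) (r \_ circle) t.
Proof.
rewrite /prim Rintegral_mkcond [RHS]Rintegral_mkcond; congr Rintegral.
apply/funext => t; rewrite !patchE.
have -> : (t \in (circle : set R)) = (0 <= t <= per).
  by apply/idP/idP; rewrite inE /circle /= in_itv.
have -> : (t \in [set` `[-1, y]]) = (-1 <= t <= y).
  by apply/idP/idP; rewrite inE /= in_itv.
have [t0|t0] /= := leP 0 t; last by case: ifP.
have -> /= : -1 <= t by lra.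
by case: leP => _; case: leP => _; rewrite ?mulr1 ?mulr0.
Qed.

Lemma cinteg_restrict r a b : cinteg r -> mu.-integrable `[a, b] (EFin \o (r \_ circle)).
Proof.
move=> ir; apply: (@integrableS _ _ _ mu setT) => //.
rewrite -restrict_EFin.
have := ir; rewrite /cinteg (@integrable_mkcond _ _ _ mu circle) //; exact: measurable_circle.
Qed.

Lemma prim_le0 r y : cinteg r -> y <= 0 -> prim r y = 0.
Proof.
move=> ir y0; rewrite primE -Rintegral_itv_bndo_bndc; last first.
  apply: (@integrableS _ _ _ mu `[-1, y]) => //; last exact: cinteg_restrict.
  exact: subset_itv_co_cc.
rewrite (@eq_Rintegral _ _ _ _ _ (fun=> 0)); first by rewrite Rintegral_cst // mul0r.
move=> t; rewrite inE /= in_itv /= => /andP[_ ty]; rewrite patchE ifF //.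
apply/negP; rewrite inE /circle /= in_itv /= => /andP[t0 _].
by have := le_lt_trans t0 (lt_le_trans ty y0); rewrite ltxx.
Qed.

Lemma prim_ge_per r y : per <= y -> prim r y = Int r.
Proof.
move=> yp; apply: eq_Rintegral => t; rewrite inE /circle /= in_itv /= => /andP[_ t1].
by rewrite (le_trans t1 yp) mulr1.
Qed.

Lemma prim_continuous r : cinteg r -> continuous (prim r).
Proof.
move=> ir y.
have [y0|y0] := ltP y 0.
  have n0 : \near y, cst 0 y = prim r y.
    by near=> z; rewrite prim_le0 // ltW //; near: z; exact: lt_nbhsl.
  rewrite /continuous_at prim_le0 ?ltW //.
  by apply: cvg_trans (near_eq_cvg n0) _; exact: cvg_cst.
have ym : -1 < y + 1 by rewrite (lt_le_trans _ (_ : 0 <= y + 1)) // ?ltrN10 // addr_ge0.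
have := @parameterized_integral_continuous R (-1) (y + 1) _ (ltW ym)
  (@cinteg_restrict r (-1) (y + 1) ir).
move=> /(continuous_within_itvP _ ym)[H _ _].
have -> : prim r = fun x => parameterized_integral mu (-1) x (r \_ circle).
  by apply/funext => x; rewrite primE.
by apply: H; rewrite in_itv /= ltrDl ltr01 andbT (lt_le_trans _ y0) // ltrN10.
Unshelve. all: by end_near. Qed.

(** Lebesgue differentiation: almost everywhere [r] is the derivative of its indefinite integral. *)
Lemma ae_eq0_of_prim r : cinteg r -> (forall y, prim r y = 0) ->
  ae_eq mu circle r (fun=> 0).
Proof.
move=> ir p0.
have := @FTC1 R (r \_ circle) (BLeft (-1)) (fun y => cinteg_restrict (-1) y ir)
  (integrable_locally (@measurable_circle R) ir).
have -> : (fun x => \int[mu]_(t in [set` Interval (BLeft (-1)) (BRight x)]) (r \_ circle) t)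
    = (fun=> 0).
  by apply/funext => x; rewrite -primE p0.
apply: filterS; first exact: (ae_filter_ringOfSetsType mu).
move=> x H xc; have [|_] := H.
  rewrite (@lte_fin R); move: xc; rewrite /circle /= in_itv /= => /andP[x0 _]; lra.
by rewrite patchE mem_set // => <-; rewrite derive1_cst.
Qed.

End Primitives.

(** * Integration by parts and the du Bois-Reymond lemma *)

Section WeakDerivatives.
Context (R : realType).

Local Notation mu := (@lebesgue_measure R).
Local Notation per := (pi *+ 2 : R).
Local Notation Int f := (\int[mu]_(y in circle) f y).

Local Notation normc := (@Normc.normc R).
Local Notation Re := (@complex.Re R).
Local Notation Im := (@complex.Im R).

Implicit Types (a b c x y z : R) (p q r s phi : R -> R).

Lemma cintegM r phi : cinteg r -> continuous phi -> cinteg (fun y => r y * phi y).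
Proof.
move=> ir cphi.
have mphi : measurable_fun circle phi.
  by apply/measurable_EFinP; exact: measurable_int (continuous_circle_integrable cphi).
apply: (@eq_integrable _ _ _ mu _ (@measurable_circle R)
  ((EFin \o r) \* (EFin \o phi))%E) => //.
apply: integrableMl => //; first exact: measurable_circle.
have [M [Mr MP]] : bounded_set (phi @` circle).
  apply: compact_bounded; apply: continuous_compact; last exact: segment_compact.
  by apply: continuous_subspaceT => z; exact: cphi.
by exists M; split => // x Mx y yc; apply: MP => //; exists y.
Qed.

Lemma continuous_cinteg phi : continuous phi -> cinteg phi.
Proof. exact: continuous_circle_integrable. Qed.

Lemma cintegB r s : cinteg r -> cinteg s -> cinteg (fun y => r y - s y).
Proof. by move=> ir js; have := integrableB (@measurable_circle R) ir js. Qed.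

Lemma cIntB r s : cinteg r -> cinteg s ->
  Int (fun y => r y - s y) = Int r - Int s.
Proof. by move=> ir js; rewrite RintegralB //; exact: measurable_circle. Qed.

Lemma cIntZr r c : cinteg r -> Int (fun y => r y * c) = Int r * c.
Proof. by move=> ir; rewrite RintegralZr //; exact: measurable_circle. Qed.

Lemma ae_eq_Int r s : cinteg r -> cinteg s -> ae_eq mu circle r s -> Int r = Int s.
Proof.
move=> ir js rs; congr fine; apply: ae_eq_integral.
- exact: measurable_circle.
- exact: measurable_int ir.
- exact: measurable_int js.
- by apply: filterS rs => x H xc; rewrite /= H.
Qed.

Lemma cintegZ r c : cinteg r -> cinteg (fun y => c * r y).
Proof. by move=> ir; have := integrableZl (@measurable_circle R) c ir. Qed.

Lemma cIntZ r c : cinteg r -> Int (fun y => c * r y) = c * Int r.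
Proof. by move=> ir; rewrite RintegralZl //; exact: measurable_circle. Qed.

Lemma cinteg_mask r (m : R -> bool) : measurable_fun setT m -> cinteg r ->
  cinteg (fun y => r y * (m y)%:R).
Proof.
move=> mm ir; apply: le_integrable (ir); first exact: measurable_circle.
  apply/measurable_EFinP; apply: measurable_funM.
    by apply/measurable_EFinP; exact: measurable_int ir.
  apply: measurable_funTS.
  have -> : (fun y => (m y)%:R : R) = (fun y => if m y then 1 else 0).
    by apply/funext => y; case: ifP.
  exact: measurable_fun_ifT.
move=> y _ /=; rewrite lee_fin normrM ler_piMr //.
by case: (m y); rewrite ?normr1 ?normr0.
Qed.

Lemma cinteg_le r a : cinteg r -> cinteg (fun y => r y * (y <= a)%R%:R).
Proof. by apply: cinteg_mask; exact: measurable_fun_ler. Qed.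

Lemma cinteg_ge r a : cinteg r -> cinteg (fun y => r y * (a <= y)%R%:R).
Proof. by apply: cinteg_mask; exact: measurable_fun_ler. Qed.

Lemma eInt_restrict r : cinteg r -> (\int[mu]_t ((r \_ circle) t)%:E = (Int r)%:E)%E.
Proof.
move=> ir; have -> : (fun t => ((r \_ circle) t)%:E) = (EFin \o r) \_ circle.
  by rewrite restrict_EFin.
rewrite -integral_mkcond fineK //.
by apply: integrable_fin_num => //; exact: measurable_circle.
Qed.

(** As [r] is merely integrable, the product rule is replaced by Fubini for r(t) phi'(y) on the
    triangle t <= y: integrating first in y gives r(t) (phi(per) - phi(t)), and first in t gives
    prim r(y) phi'(y). *)
Lemma parts r phi phi' : cinteg r -> has_deriv phi phi' -> continuous phi' ->
  Int (fun y => prim r y * phi' y) = Int r * phi per - Int (fun y => r y * phi y).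
Proof.
move=> ir dphi cphi'.
have mC := @measurable_circle R.
have cphi := has_deriv_continuous dphi.
pose A := r \_ circle; pose B := phi' \_ circle.
pose f (ty : R * R) : \bar R := (A ty.1 * B ty.2 * (ty.1 <= ty.2)%R%:R)%:E.
have iA : mu.-integrable setT (EFin \o A).
  by have := ir; rewrite /cinteg (@integrable_mkcond _ _ _ mu circle) // restrict_EFin.
have iB : mu.-integrable setT (EFin \o B).
  have := continuous_cinteg cphi'.
  by rewrite /cinteg (@integrable_mkcond _ _ _ mu circle) // restrict_EFin.
have mA : measurable_fun setT A by apply/measurable_EFinP; exact: measurable_int iA.
have mB : measurable_fun setT B by apply/measurable_EFinP; exact: measurable_int iB.
have mle : measurable_fun setT (fun ty : R * R => (ty.1 <= ty.2)%R%:R : R).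
  have -> : (fun ty : R * R => (ty.1 <= ty.2)%R%:R : R) =
      (fun ty => if (ty.1 <= ty.2)%R then 1 else 0).
    by apply/funext => ty; case: ifP.
  by apply: measurable_fun_ifT => //; apply: measurable_fun_ler.
have mf : measurable_fun setT f.
  apply/measurable_EFinP; apply: measurable_funM => //.
  apply: measurable_funM.
    exact: (measurableT_comp mA measurable_fst).
  exact: (measurableT_comp mB measurable_snd).
have [C C0 BC] : exists2 C, 0 < C & forall y, `|B y| <= C * \1_(circle : set R) y.
  have [M [Mr MP]] : bounded_set (phi' @` circle).
    apply: compact_bounded; apply: continuous_compact; last exact: segment_compact.
    by apply: continuous_subspaceT => z; exact: cphi'.
  exists (`|M| + 1); first by rewrite ltr_wpDl.
  move=> y; rewrite /B patchE indicE; case: ifPn => yc; last by rewrite normr0 mulr0.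
  rewrite mulr1; apply: (MP (`|M| + 1)); last by exists y => //; exact: set_mem.
  by rewrite (le_lt_trans (ler_norm _)) // ltrDl.
(* Absolute integrability on the plane: phi' is bounded on the circle, which has finite measure. *)
have bound : (\int[mu]_t \int[mu]_y `|f (t, y)| < +oo)%E.
  have bnd t : (\int[mu]_y `|f (t, y)| <= (`|A t| * C * per)%:E)%E.
    have -> : (`|A t| * C * per)%:E = (\int[mu]_y (`|A t| * C * \1_(circle : set R) y)%:E)%E.
      under eq_integral do rewrite EFinM.
      rewrite ge0_integralZl //; first last.
      - by rewrite lee_fin mulr_ge0 // ltW.
      - by apply/measurable_EFinP; exact: measurable_indic.
      rewrite integral_indic // setIT [X in (_ * X)%E](_ : _ = per%:E) ?EFinM //.
      have E : mu circle = per%:E.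
        by rewrite /circle lebesgue_measure_itv /= lte_fin per_gt0 -EFinB subr0.
      exact: E.
    apply: ge0_le_integral => //.
    - by apply: measurableT_comp => //; apply: measurableT_comp mf (measurable_pair1 t).
    - by apply/measurable_EFinP; apply: measurable_funM => //; exact: measurable_indic.
    - move=> y _; rewrite /f /= lee_fin !normrM -mulrA -mulrA ler_wpM2l //.
      apply: le_trans (BC y); rewrite ler_piMr //.
      by case: (t <= y); rewrite ?normr1 ?normr0.
  apply: (@le_lt_trans _ _ (\int[mu]_t ((C * per)%:E * (EFin \o (@Num.norm _ R \o A)) t))%E).
    apply: ge0_le_integral => //.
    - by move=> t _; exact: integral_ge0.
    - apply: (@measurable_fun_fubini_tonelli_F _ _ _ _ _ mu (abse \o f)) => //=.
      exact: measurableT_comp.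
    - apply/measurable_EFinP; apply: measurable_funM => //.
      by apply: measurableT_comp.
    - move=> t _; apply: le_trans (bnd t) _.
      by rewrite -EFinM lee_fin -mulrA mulrC.
  have iAn := integrableZl measurableT (C * per) (integrable_norm iA).
  have mAn := measurable_int _ iAn.
  have /integrableP[_] := iAn; apply: le_lt_trans; apply: ge0_le_integral => //.
  - move=> t _; rewrite -EFinM lee_fin; apply: mulr_ge0; last exact: normr_ge0.
    by apply: mulr_ge0; apply: ltW => //; exact: per_gt0.
  - by apply: measurableT_comp => //; exact: mAn.
  - by move=> t _; exact: lee_abs.
have Fub := Fubini ((@integrable12ltyP _ _ _ _ _ mu mu f mf).2 bound).
have inner1 t : (\int[mu]_y f (t, y) = (((fun t => r t * (phi per - phi t)) \_ circle) t)%:E)%E.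
  rewrite patchE; case: ifPn => tc; last first.
    rewrite (_ : (fun y => _) = cst 0%E) ?integral0 //.
    by apply/funext => y; rewrite /f /A /= patchE (negbTE tc) !mul0r.
  have := tc; rewrite inE /circle /= in_itv /= => /andP[t0 t1].
  transitivity ((Int (fun y => r t * (phi' y * (t <= y)%R%:R)))%:E).
    rewrite -(eInt_restrict (cintegZ (r t) (cinteg_ge t (continuous_cinteg cphi')))).
    apply: eq_integral => y _; rewrite /f /A /B /= !patchE tc.
    by case: ifP => _; rewrite ?mulr0 ?mul0r // mulrA.
  rewrite cIntZ; last exact: cinteg_ge (continuous_cinteg cphi').
  congr (_ * _)%:E; rewrite Rintegral_mkcond.
  have -> : (fun y => phi' y * (t <= y)%R%:R) \_ circle = phi' \_ `[t, per].
    apply/funext => y; rewrite !patchE.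
    have -> : (y \in (circle : set R)) = (0 <= y <= per).
      by apply/idP/idP; rewrite inE /circle /= in_itv.
    have -> : (y \in [set` `[t, per]]) = (t <= y <= per).
      by apply/idP/idP; rewrite inE /= in_itv.
    case: (leP t y) => ty /=; last by rewrite mulr0; case: ifP.
    by rewrite mulr1 (le_trans t0 ty).
  by rewrite -Rintegral_mkcond (FTC2 dphi cphi' t1).
have inner2 y : (\int[mu]_t f (t, y) = (((fun y => prim r y * phi' y) \_ circle) y)%:E)%E.
  have -> : ((fun y => prim r y * phi' y) \_ circle) y = B y * prim r y.
    by rewrite /B !patchE; case: ifP; rewrite ?mul0r // mulrC.
  rewrite -cIntZ; last exact: cinteg_le.
  rewrite -eInt_restrict; last exact: cintegZ (cinteg_le y ir).
  apply: eq_integral => t _; rewrite /f /A /= !patchE.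
  by case: ifP => _; rewrite ?mul0r // mulrAC [B y * _]mulrC.
move: Fub; under eq_integral do rewrite inner1.
under [in RHS]eq_integral do rewrite inner2.
have cd : continuous (fun t => phi per - phi t).
  by apply: continuousD_fun; [move=> ?; exact: cst_continuous|exact: continuousN_fun].
rewrite eInt_restrict; last exact: cintegM.
rewrite eInt_restrict; last first.
  have := cintegM (continuous_cinteg (prim_continuous ir)) cphi'; exact.
move=> [<-].
rewrite -cIntZr // -cIntB; [|by apply: cintegM => // ?; exact: cst_continuous|exact: cintegM].
by apply: eq_Rintegral => t _; rewrite mulrBr.
Qed.

Lemma test_deriv phi phi' : has_deriv phi phi' -> periodic phi per ->
  continuous phi' -> is_Ck 1 phi.
Proof.
move=> d pp c; split => //.
- by move=> [|//] y _; rewrite /derive1n /=; case: (d y).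
- by rewrite /derive1n /= (has_derivE d).
Qed.

Lemma is_Ck1P phi : is_Ck 1 phi ->
  [/\ has_deriv phi (derive1 phi), pcont phi & continuous (derive1 phi)].
Proof.
move=> [pp d c].
have dphi : has_deriv phi (derive1 phi).
  by move=> y; rewrite derive1E; apply: derivableP; exact: (d 0%N y).
by split => //; split => //; exact: has_deriv_continuous dphi.
Qed.

(** The test function 1 gives [r] zero mean, so its primitive closes up to a continuous periodic [E]
    of mean m. Testing with a primitive of E - m and integrating by parts gives int (E - m)^2 = 0;
    hence [E] is constant, and E(0) = 0. *)
Lemma ae_eq0_of_test r : cinteg r ->
  (forall phi, is_Ck 1 phi -> Int (fun y => r y * phi y) = 0) ->
  ae_eq mu circle r (fun=> 0).
Proof.
move=> ir H.
have Ir : Int r = 0.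
  rewrite -(H (fun=> 1)); first by apply: eq_Rintegral => y _; rewrite mulr1.
  by apply: test_deriv (has_deriv_cst _) _ _ => // ?; exact: cst_continuous.
have cp := prim_continuous ir.
have [E [pE cE] Er] := periodic_extension cp (fun y => prim_le0 ir)
  (fun y yp => etrans (prim_ge_per r yp) Ir).
pose m := Int E / per.
have cEm : pcont (fun y => E y - m) by apply: pcontB => //; exact: pcont_cst.
have IEm : Int (fun y => E y - m) = 0.
  rewrite IntB //; last by move=> ?; exact: cst_continuous.
  by rewrite Int_cst /m mulrC divfK ?subrr // lt0r_neq0 // per_gt0.
have [psi [dpsi [ppsi _] _]] := pcont_primitive cEm IEm.
have := parts ir dpsi (proj2 cEm).
rewrite (H psi); last exact: test_deriv dpsi ppsi (proj2 cEm).
rewrite Ir mul0r subrr => HE.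
have {}HE : Int (fun y => (E y - m) * (E y - m)) = 0.
  under eq_Rintegral do rewrite mulrBl.
  rewrite IntB; first last.
  - by apply: continuousM_fun; [move=> ?; exact: cst_continuous|case: cEm].
  - by apply: continuousM_fun => //; case: cEm.
  rewrite IntZ; last by case: cEm.
  rewrite IEm mulr0 subr0 -HE; apply: eq_Rintegral => y; rewrite inE => yc.
  by rewrite Er.
have Em := Int_sqr_eq0 cEm HE.
have Ec y : E y = E 0.
  have := congr1 (fun u => u y - u 0) Em; rewrite /= subrr => /eqP.
  by rewrite opprB addrA subrK subr_eq0 => /eqP.
have E0 : E 0 = 0.
  by rewrite Er ?prim_le0 // /circle /= in_itv /= lexx ltW // per_gt0.
apply: ae_eq0_of_prim => // y.
have [/(prim_le0 ir)//|y0] := leP y 0.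
have [/(prim_ge_per r)->//|y1] := leP per y.
by rewrite -Er ?Ec // /circle /= in_itv /= !ltW.
Qed.

(** Every continuous periodic function of zero mean is the derivative of a test function. Applied to
    phi minus its mean, the hypothesis shows that [r] minus its mean annihilates every phi. *)
Lemma ae_cst_of_test r : cinteg r ->
  (forall phi, is_Ck 1 phi -> Int (fun y => r y * derive1 phi y) = 0) ->
  exists c, ae_eq mu circle r (fun=> c).
Proof.
move=> ir H; pose c := Int r / per; exists c.
have pn0 : per != 0 :> R by rewrite lt0r_neq0 // per_gt0.
have cc (x : R) : continuous (fun _ : R => x) by move=> ?; exact: cst_continuous.
have irc : cinteg (fun y => r y - c) by apply: cintegB => //; exact: continuous_cinteg.
have : ae_eq mu circle (fun y => r y - c) (fun=> 0).
  apply: ae_eq0_of_test => // phi /is_Ck1P[_ pphi _]; have [_ cphi] := pphi.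
  pose m := Int phi / per.
  have cEm : pcont (fun y => phi y - m) by apply: pcontB => //; exact: pcont_cst.
  have IEm : Int (fun y => phi y - m) = 0.
    by rewrite IntB // Int_cst /m mulrC divfK ?subrr.
  have [psi [dpsi [ppsi _] _]] := pcont_primitive cEm IEm.
  have := H psi (test_deriv dpsi ppsi (proj2 cEm)); rewrite (has_derivE dpsi) => H0.
  under eq_Rintegral do rewrite mulrBl.
  rewrite cIntB; [|exact: cintegM|exact: continuous_cinteg (continuousM_fun _ _)].
  rewrite IntZ //; move: H0.
  under eq_Rintegral do rewrite mulrBr.
  rewrite cIntB; [|exact: cintegM|exact: cintegM].
  rewrite cIntZr // => /eqP; rewrite subr_eq0 => /eqP ->.
  by rewrite /c /m mulrCA mulrC -mulrA subrr.
apply: filterS => y h yc; apply/eqP; rewrite -subr_eq0; apply/eqP; exact: h.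
Qed.

(** [r] minus the primitive of [s] has zero weak derivative, so it is constant. Testing with 1 gives
    [s] zero mean, which makes the primitive periodic. *)
Lemma weak_regularity r s : cinteg r -> cinteg s ->
  (forall phi, is_Ck 1 phi ->
     Int (fun y => r y * derive1 phi y) = - Int (fun y => s y * phi y)) ->
  exists2 E, pcont E & ae_eq mu circle r E.
Proof.
move=> ir js H.
have Is : Int s = 0.
  have /H := test_deriv (has_deriv_cst (1 : R)) (fun _ => erefl)
    (fun x => @cst_continuous _ _ _ x).
  under [in LHS]eq_Rintegral do rewrite (has_derivE (has_deriv_cst (1 : R))) mulr0.
  under [in RHS]eq_Rintegral do rewrite mulr1.
  by rewrite Int_cst mulr0 => /eqP; rewrite eq_sym oppr_eq0 => /eqP.
have cp := prim_continuous js.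
have [E pE Er] := periodic_extension cp (fun y => prim_le0 js)
  (fun y yp => etrans (prim_ge_per s yp) Is).
have irp : cinteg (fun y => r y - prim s y).
  by apply: cintegB => //; exact: continuous_cinteg.
have [|c Hc] := ae_cst_of_test irp.
  move=> phi tphi; have [dphi pphi cphi'] := is_Ck1P tphi.
  under eq_Rintegral do rewrite mulrBl.
  rewrite cIntB; [|exact: cintegM|exact/continuous_cinteg/continuousM_fun].
  by rewrite H // (parts js dphi cphi') Is mul0r sub0r opprK addNr.
exists (fun y => E y + c); first by apply: pcontD => //; exact: pcont_cst.
apply: filterS Hc => y h yc; rewrite Er // -(h yc); ring.
Qed.

(** When the weak derivative is continuous, a classical periodic primitive replaces [prim], and the
    representative becomes C^1. *)
Lemma weak_deriv_continuous r s S : cinteg r -> cinteg s -> pcont S ->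
  ae_eq mu circle s S ->
  (forall phi, is_Ck 1 phi ->
     Int (fun y => r y * derive1 phi y) = - Int (fun y => s y * phi y)) ->
  exists E, [/\ has_deriv E S, pcont E & ae_eq mu circle r E].
Proof.
move=> ir js pS sS H; have [pS1 cS] := pS.
have HS phi : continuous phi -> Int (fun y => s y * phi y) = Int (fun y => S y * phi y).
  move=> cphi; apply: ae_eq_Int; first exact: cintegM.
    exact/continuous_cinteg/continuousM_fun.
  by apply: filterS sS => y h yc; rewrite h.
have cc (x : R) : continuous (fun _ : R => x) by move=> ?; exact: cst_continuous.
have IS : Int S = 0.
  have /H := test_deriv (has_deriv_cst (1 : R)) (fun _ => erefl) (cc 0).
  under [in LHS]eq_Rintegral do rewrite (has_derivE (has_deriv_cst (1 : R))) mulr0.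
  rewrite HS //.
  under [in RHS]eq_Rintegral do rewrite mulr1.
  by rewrite Int_cst mulr0 => /eqP; rewrite eq_sym oppr_eq0 => /eqP.
have [E [dE pE _]] := pcont_primitive pS IS.
have cE := proj2 pE.
have irp : cinteg (fun y => r y - E y).
  by apply: cintegB => //; exact: continuous_cinteg.
have [|c Hc] := ae_cst_of_test irp.
  move=> phi tphi; have [dphi pphi cphi'] := is_Ck1P tphi.
  have cphi := proj2 pphi.
  under eq_Rintegral do rewrite mulrBl.
  rewrite cIntB; [|exact: cintegM|exact/continuous_cinteg/continuousM_fun].
  rewrite H // HS //.
  have : Int (fun y => E y * derive1 phi y + S y * phi y) = 0.
    apply: Int_deriv (has_derivM dE dphi) _ _.
      by apply: continuousD_fun; exact: continuousM_fun.
    by move=> y; rewrite (proj1 pE) (proj1 pphi).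
  rewrite IntD; [|exact: continuousM_fun|exact: continuousM_fun].
  by move=> h; rewrite -opprD addrC h oppr0.
exists (fun y => E y + c); split.
- by apply: has_deriv_eq (has_derivD dE (has_deriv_cst c)) _ => y; rewrite addr0.
- by apply: pcontD => //; exact: pcont_cst.
- by apply: filterS Hc => y h yc; rewrite -(h yc); ring.
Qed.

End WeakDerivatives.

(** * Sobolev functions and their classical representatives *)

Section SobolevFunctions.
Context (R : realType).
Implicit Types (a b x y : R) (u : R -> R) (z w c : R[i]) (f g h k v : R -> R[i]).
Local Notation mu := (@lebesgue_measure R).
Local Notation per := (pi *+ 2 : R).
Local Notation Int f := (\int[mu]_(y in circle) f y).

Local Notation normc := (@Normc.normc R).
Local Notation Re := (@complex.Re R).
Local Notation Im := (@complex.Im R).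

Local Notation mcircle := (@measurable_circle R).

Lemma L2_cinteg f : L2 f -> cinteg (fun y => Re (f y)) /\ cinteg (fun y => Im (f y)).
Proof.
move=> [m1 m2 i2].
have i1 : mu.-integrable circle
    (fun y => (1 + (Re (f y) ^+ 2 + Im (f y) ^+ 2))%:E).
  have h : cinteg (fun _ : R => 1 : R).
    by apply: continuous_cinteg => x; exact: cst_continuous.
  by have := integrableD mcircle h i2.
(* From (|x| - 1)^2 >= 0; this is the inclusion of L^2 in L^1 on a set of finite measure. *)
have sq (x t : R) : 0 <= t -> `|x| <= 1 + (x ^+ 2 + t) /\ `|x| <= 1 + (t + x ^+ 2).
  move=> t0; have : 0 <= (`|x| - 1) ^+ 2 by exact: sqr_ge0.
  rewrite sqrrB real_normK ?num_real // expr1n mulr1 mulr2n => h.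
  by have := normr_ge0 x; split; lra.
split; apply: le_integrable i1 => //; try exact: measurable_circle.
- exact/measurable_EFinP.
- move=> y _ /=; rewrite lee_fin (le_trans _ (ler_norm _)) //.
  by case: (sq (Re (f y)) _ (sqr_ge0 (Im (f y)))).
- exact/measurable_EFinP.
- move=> y _ /=; rewrite lee_fin (le_trans _ (ler_norm _)) //.
  by case: (sq (Im (f y)) _ (sqr_ge0 (Re (f y)))).
Qed.

Lemma cpcont_L2 f : cpcont f -> L2 f.
Proof.
move=> [[_ c1] [_ c2]]; split.
- by apply/measurable_EFinP; exact: measurable_int (continuous_cinteg c1).
- by apply/measurable_EFinP; exact: measurable_int (continuous_cinteg c2).
- apply: (@continuous_cinteg _ (fun y => Re (f y) ^+ 2 + Im (f y) ^+ 2)).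
  have -> : (fun y => Re (f y) ^+ 2 + Im (f y) ^+ 2) =
      (fun y => Re (f y) * Re (f y) + Im (f y) * Im (f y)).
    by apply/funext => y; rewrite !expr2.
  by apply: continuousD_fun; exact: continuousM_fun.
Qed.

Lemma cintegral_test f (u : R -> R) :
  cintegral (fun y => f y * (u y)%:C) =
  Int (fun y => Re (f y) * u y) +i* Int (fun y => Im (f y) * u y).
Proof.
apply: complex_eqP; apply: eq_Rintegral => y _; rewrite !ReImE /=;
  by rewrite ?mulr0 ?subr0 ?add0r.
Qed.

Lemma weak_deriv_parts f g : weak_deriv f g -> forall phi, is_Ck 1 phi ->
  Int (fun y => Re (f y) * derive1 phi y) = - Int (fun y => Re (g y) * phi y) /\
  Int (fun y => Im (f y) * derive1 phi y) = - Int (fun y => Im (g y) * phi y).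
Proof. by move=> [_ _ H] phi /H; rewrite !cintegral_test => -[-> ->]. Qed.

Lemma weak_derivP f g : L2 f -> L2 g -> (forall phi, is_Ck 1 phi ->
  Int (fun y => Re (f y) * derive1 phi y) = - Int (fun y => Re (g y) * phi y) /\
  Int (fun y => Im (f y) * derive1 phi y) = - Int (fun y => Im (g y) * phi y)) ->
  weak_deriv f g.
Proof.
by move=> Lf Lg H; split => // phi /H[h1 h2]; rewrite !cintegral_test h1 h2.
Qed.

Lemma ae_circleRe f g : ae_circle f g ->
  ae_eq mu circle (fun y => Re (f y)) (fun y => Re (g y)).
Proof. by apply: filterS => y h yc; rewrite h. Qed.

Lemma ae_circleIm f g : ae_circle f g ->
  ae_eq mu circle (fun y => Im (f y)) (fun y => Im (g y)).
Proof. by apply: filterS => y h yc; rewrite h. Qed.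

Lemma ae_circleP f g : ae_eq mu circle (fun y => Re (f y)) (fun y => Re (g y)) ->
  ae_eq mu circle (fun y => Im (f y)) (fun y => Im (g y)) -> ae_circle f g.
Proof. by apply: filterS2 => y h1 h2 yc; apply: complex_eqP; [exact: h1|exact: h2]. Qed.

Lemma ae_circle_refl f : ae_circle f f. Proof. exact: ae_eq_refl. Qed.

Lemma ae_circle_sym f g : ae_circle f g -> ae_circle g f.
Proof. exact: ae_eq_sym. Qed.

Lemma ae_circle_trans f g h : ae_circle f g -> ae_circle g h -> ae_circle f h.
Proof. exact: ae_eq_trans. Qed.

Lemma weak_deriv_unique f g g' : weak_deriv f g -> weak_deriv f g' -> ae_circle g g'.
Proof.
move=> wg wg'; have H := weak_deriv_parts wg; have H' := weak_deriv_parts wg'.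
have [_ Lg _] := wg; have [_ Lg' _] := wg'.
have [i1 i2] := L2_cinteg Lg; have [i1' i2'] := L2_cinteg Lg'.
have aux (p q : R -> R) : cinteg p -> cinteg q ->
    (forall phi, is_Ck 1 phi -> Int (fun y => p y * phi y) = Int (fun y => q y * phi y)) ->
    ae_eq mu circle p q.
  move=> ip iq pq.
  have : ae_eq mu circle (fun y => p y - q y) (fun=> 0).
    apply: ae_eq0_of_test; first exact: cintegB.
    move=> phi tphi; have [_ [_ cphi] _] := is_Ck1P tphi.
    under eq_Rintegral do rewrite mulrBl.
    by rewrite cIntB ?pq ?subrr //; exact: cintegM.
  by apply: filterS => y h yc; apply/eqP; rewrite -subr_eq0; apply/eqP; exact: h.
apply: ae_circleP; apply: aux => // phi tphi; apply: oppr_inj.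
- by case: (H _ tphi) => <- _; case: (H' _ tphi) => <-.
- by case: (H _ tphi) => _ <-; case: (H' _ tphi) => _ <-.
Qed.

Lemma weak_deriv_ae f f' g : L2 f' -> ae_circle f f' -> weak_deriv f g -> weak_deriv f' g.
Proof.
move=> Lf' ff' w; have [Lf Lg _] := w; apply: weak_derivP => // phi tphi.
have [h1 h2] := weak_deriv_parts w tphi.
have [_ _ cphi'] := is_Ck1P tphi.
have [i1 i2] := L2_cinteg Lf; have [i1' i2'] := L2_cinteg Lf'.
rewrite -h1 -h2; split; apply: ae_eq_Int; try exact: cintegM.
- by apply: filterS (ae_circleRe ff') => y h yc; rewrite h.
- by apply: filterS (ae_circleIm ff') => y h yc; rewrite h.
Qed.

Lemma classical_weak_deriv f g : chas_deriv f g -> cpcont f -> cpcont g -> weak_deriv f g.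
Proof.
move=> [d1 d2] cf cg; apply: weak_derivP; [exact: cpcont_L2|exact: cpcont_L2|].
move=> phi tphi; have [dphi [pphi cphi] cphi'] := is_Ck1P tphi.
have [[pf1 cf1] [pf2 cf2]] := cf; have [[_ cg1] [_ cg2]] := cg.
have aux (p q : R -> R) : has_deriv p q -> continuous p -> continuous q ->
    periodic p per -> Int (fun y => p y * derive1 phi y) = - Int (fun y => q y * phi y).
  move=> dp cp cq pp; apply/eqP; rewrite -addr_eq0 -IntD; [|exact: continuousM_fun..].
  apply/eqP/(Int_deriv (has_derivM dp dphi)).
    by apply: continuousD_fun; exact: continuousM_fun.
  by move=> y; rewrite pp pphi.
by split; exact: aux.
Qed.

Lemma DyP f g : weak_deriv f g -> weak_deriv f (Dy f).
Proof. by move=> w; exact: (@xgetPex _ (fun=> 0) [set g | weak_deriv f g] (ex_intro _ g w)). Qed.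

Lemma sobolev_ae n f f' : L2 f' -> ae_circle f f' -> sobolev n f -> sobolev n f'.
Proof.
by case: n => [//|n] Lf' ff' [g w s]; exists g => //; exact: weak_deriv_ae w.
Qed.

Lemma sobolevS n f : sobolev n.+1 f -> weak_deriv f (Dy f) /\ sobolev n (Dy f).
Proof.
move=> [g w s]; have w' := DyP w; split => //.
by apply: sobolev_ae s; [case: w'|exact: weak_deriv_unique w w'].
Qed.

Lemma sobolev_continuous f : sobolev 1 f -> exists2 F, cpcont F & ae_circle f F.
Proof.
move=> [g w _]; have [/L2_cinteg[f1 f2] /L2_cinteg[g1 g2] _] := w.
have H := weak_deriv_parts w.
have [F1 cF1 H1] := weak_regularity f1 g1 (fun phi t => proj1 (H phi t)).
have [F2 cF2 H2] := weak_regularity f2 g2 (fun phi t => proj2 (H phi t)).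
by exists (fun y => F1 y +i* F2 y); [split|exact: ae_circleP].
Qed.

Lemma weak_deriv_classical f g G : weak_deriv f g -> cpcont G -> ae_circle g G ->
  exists F, [/\ chas_deriv F G, cpcont F & ae_circle f F].
Proof.
move=> w [G1 G2] gG; have [/L2_cinteg[f1 f2] /L2_cinteg[g1 g2] _] := w.
have H := weak_deriv_parts w.
have [F1 [d1 c1 H1]] := weak_deriv_continuous f1 g1 G1 (ae_circleRe gG)
  (fun phi t => proj1 (H phi t)).
have [F2 [d2 c2 H2]] := weak_deriv_continuous f2 g2 G2 (ae_circleIm gG)
  (fun phi t => proj2 (H phi t)).
by exists (fun y => F1 y +i* F2 y); split; [split|split|exact: ae_circleP].
Qed.

Definition has_deriv2 f g :=
  exists f1, [/\ chas_deriv f f1, chas_deriv f1 g, cpcont f & cpcont f1].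

Lemma has_deriv2_cpcont f g : has_deriv2 f g -> cpcont f.
Proof. by case=> ? []. Qed.

Lemma has_deriv2_eq f g h : has_deriv2 f g -> g =1 h -> has_deriv2 f h.
Proof. by move=> d /funext E; rewrite -E. Qed.

Lemma has_deriv2B f f' g g' : has_deriv2 f f' -> has_deriv2 g g' ->
  has_deriv2 (fun y => f y - g y) (fun y => f' y - g' y).
Proof.
move=> [f1 [df df1 cf cf1]] [g1 [dg dg1 cg cg1]]; exists (fun y => f1 y - g1 y).
by split; [exact: chas_derivB|exact: chas_derivB|exact: cpcontB|exact: cpcontB].
Qed.

Lemma has_deriv2D f f' g g' : has_deriv2 f f' -> has_deriv2 g g' ->
  has_deriv2 (fun y => f y + g y) (fun y => f' y + g' y).
Proof.
move=> [f1 [df df1 cf cf1]] [g1 [dg dg1 cg cg1]]; exists (fun y => f1 y + g1 y).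
by split; [exact: chas_derivD|exact: chas_derivD|exact: cpcontD|exact: cpcontD].
Qed.

Lemma has_deriv2Z c f f' : has_deriv2 f f' ->
  has_deriv2 (fun y => c * f y) (fun y => c * f' y).
Proof.
move=> [f1 [df df1 cf cf1]]; exists (fun y => c * f1 y).
by split; [exact: chas_derivZ|exact: chas_derivZ|exact: cpcontZ|exact: cpcontZ].
Qed.

Lemma has_deriv2_cst c : has_deriv2 (fun=> c) (fun=> 0).
Proof.
by exists (fun=> 0); split; [exact: chas_deriv_cst..|exact: cpcont_cst|exact: cpcont_cst].
Qed.

Lemma has_deriv2_mean f g : has_deriv2 f g -> cpcont g -> cintegral g = 0.
Proof. by move=> [f1 [_ d _ c]] cg; exact: cintegral_deriv d c cg. Qed.

Lemma sol_has_deriv2 z v k : sol z v k -> has_deriv2 v (fun y => z * v y + k y).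
Proof. by move=> [v1 [? ? ? ? _]]; exists v1. Qed.

Lemma has_deriv2_sol z v k : has_deriv2 v (fun y => z * v y + k y) ->
  cintegral v = 0 -> sol z v k.
Proof. by move=> [v1 [? ? ? ?]] I; exists v1. Qed.

(** Regularity is gained from the top derivative downwards: a continuous second derivative makes the
    first one C^1 and the function C^2, up to null sets. *)
Lemma sobolev2_classical f G : sobolev 2 f -> cpcont G -> ae_circle (Dyn 2 f) G ->
  exists2 F, has_deriv2 F G & ae_circle f F.
Proof.
move=> /sobolevS[w /sobolevS[w' _]] cG fG.
have [F1 [d1 c1 H1]] := weak_deriv_classical w' cG fG.
have [F [d c H]] := weak_deriv_classical w c1 H1.
by exists F => //; exists F1.
Qed.

Lemma classical_sobolev2 F G : has_deriv2 F G -> cpcont G ->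
  sobolev 2 F /\ ae_circle (Dyn 2 F) G.
Proof.
move=> [F1 [d d1 c c1]] cG.
have w := classical_weak_deriv d c c1; have w1 := classical_weak_deriv d1 c1 cG.
split; first by exists F1 => //; exists G => //; exact: cpcont_L2.
have wD := DyP w; have FD := weak_deriv_unique w wD.
have LD : L2 (Dy F) by case: wD.
have w2 := weak_deriv_ae LD FD w1.
exact: weak_deriv_unique (DyP w2) w2.
Qed.

Lemma classical_sobolev4 F G H : has_deriv2 F G -> has_deriv2 G H -> cpcont H ->
  sobolev 4 F /\ ae_circle (Dyn 4 F) H.
Proof.
move=> [F1 [d d1 c c1]] [G1 [d2 d3 c2 c3]] cH.
have w := classical_weak_deriv d c c1; have w1 := classical_weak_deriv d1 c1 c2.
have w2 := classical_weak_deriv d2 c2 c3; have w3 := classical_weak_deriv d3 c3 cH.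
split.
  by exists F1 => //; exists G => //; exists G1 => //; exists H => //; exact: cpcont_L2.
(* [Dy] returns the classical derivative only almost everywhere, so the next weak derivative must be
   carried over to the chosen representative. *)
have step f f' g g' : weak_deriv f f' -> weak_deriv f' g' -> ae_circle g f' ->
    L2 g -> weak_deriv g (Dy g) /\ ae_circle (Dy g) g'.
  move=> wf wf' gf' Lg.
  have wg := weak_deriv_ae Lg (ae_circle_sym gf') wf'.
  by have wD := DyP wg; split => //; exact: weak_deriv_unique wD wg.
have wD := DyP w; have a1 := weak_deriv_unique wD w.
have [wD1 a2] := step _ _ _ _ w w1 a1 (let: And3 _ L _ := wD in L).
have [wD2 a3] := step _ _ _ _ w1 w2 a2 (let: And3 _ L _ := wD1 in L).
by have [wD3 a4] := step _ _ _ _ w2 w3 a3 (let: And3 _ L _ := wD2 in L).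
Qed.

Lemma ae_cpcont_eq f g : cpcont f -> cpcont g -> ae_circle f g -> f = g.
Proof.
move=> [f1 f2] [g1 g2] fg.
have aux (p q : R -> R) : pcont p -> pcont q -> ae_eq mu circle p q -> p = q.
  move=> cp cq pq; have cpq := pcontB cp cq.
  have : Int (fun y => (p y - q y) * (p y - q y)) = 0.
    have -> : (0 : R) = Int (fun=> 0) by rewrite Int_cst mulr0.
    have [_ cpq'] := cpq.
    apply: ae_eq_Int.
    - exact/continuous_cinteg/continuousM_fun.
    - by apply: continuous_cinteg => ?; exact: cst_continuous.
    - by apply: filterS pq => y h yc; rewrite h // subrr mul0r.
  move/(Int_sqr_eq0 cpq) => E; apply/funext => y.
  by apply/eqP; rewrite -subr_eq0; apply/eqP; exact: (congr1 (@^~ y) E).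
have E1 := aux _ _ f1 g1 (ae_circleRe fg); have E2 := aux _ _ f2 g2 (ae_circleIm fg).
apply/funext => y; apply: complex_eqP; first exact: (congr1 (@^~ y) E1).
exact: (congr1 (@^~ y) E2).
Qed.

Section Helmholtz.
Context (eps : R) (eps0 : 0 < eps).
Let eps2 : R[i] := (eps ^+ 2)%:C.

Lemma eps2_neq0 : eps2 != 0.
Proof. by rewrite /eps2 fmorph_eq0 expf_neq0 // lt0r_neq0. Qed.

(** [sol] handles the mean-free part; the mean m of [F] contributes the constant -m / eps^2. *)
Lemma helmholtz_classical_exists F : cpcont F ->
  exists psi, has_deriv2 psi (fun y => eps2 * psi y + F y).
Proof.
move=> cF; pose m := cmean F.
have mF : mean0 (fun y => F y - m).
  split; first by apply: cpcontB => //; exact: cpcont_cst.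
  by apply/cmean0P; rewrite cmeanB ?cmean_cst ?subrr //; exact: cpcont_cst.
have [e se] := @sol_exists _ eps2 _ (sqr_ge0 eps) mF.
exists (fun y => e y - m / eps2).
apply: has_deriv2_eq (has_deriv2B (sol_has_deriv2 se) (has_deriv2_cst (m / eps2))) _ => y.
by rewrite mulrBr mulrCA divff ?eps2_neq0 //; ring.
Qed.

(** Integrating the equation of the difference shows that its mean times eps^2 vanishes, which
    reduces the claim to the mean-free case. *)
Lemma helmholtz_classical_unique F psi psi' : cpcont F ->
  has_deriv2 psi (fun y => eps2 * psi y + F y) ->
  has_deriv2 psi' (fun y => eps2 * psi' y + F y) -> psi = psi'.
Proof.
move=> cF d d'; have dd := has_deriv2B d d'.
have cpsi := has_deriv2_cpcont d; have cpsi' := has_deriv2_cpcont d'.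
have {}dd : has_deriv2 (fun y => psi y - psi' y)
    (fun y => eps2 * (psi y - psi' y) + (fun=> 0) y).
  by apply: has_deriv2_eq dd _ => y; rewrite /=; ring.
have I0 : cintegral (fun y => psi y - psi' y) = 0.
  have cB := cpcontB cpsi cpsi'.
  have := has_deriv2_mean dd (cpcontD (cpcontZ eps2 cB) (cpcont_cst 0)).
  rewrite (cintegralD (cpcontZ eps2 cB) (cpcont_cst 0)).
  rewrite cintegralZ // cintegral_cst mulr0 addr0 => /eqP.
  by rewrite mulf_eq0 (negbTE eps2_neq0) => /eqP.
have s1 := has_deriv2_sol dd I0.
have s2 : sol eps2 (fun=> 0) (fun=> 0).
  apply: has_deriv2_sol; last by rewrite cintegral_cst mulr0.
  by apply: has_deriv2_eq (has_deriv2_cst 0) _ => y; rewrite mulr0 addr0.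
have := @sol_unique _ eps2 _ _ _ (sqr_ge0 eps) s1 s2.
move=> E; apply/funext => y; apply/eqP; rewrite -subr_eq0; apply/eqP.
exact: (congr1 (@^~ y) E).
Qed.

(** The classical solution shows that the choice in [op_inv] has a candidate. The chosen one has a
    continuous representative, so by its equation its second derivative is continuous almost
    everywhere; it is therefore classical, and uniqueness applies. *)
Lemma op_inv_helmholtz f F psi : cpcont F -> ae_circle f F ->
  has_deriv2 psi (fun y => eps2 * psi y + F y) ->
  ae_circle (op_inv (sobolev 2) (helmholtz eps) f) psi.
Proof.
move=> cF fF dpsi; have cpsi := has_deriv2_cpcont dpsi.
have cG : cpcont (fun y => eps2 * psi y + F y) by apply: cpcontD => //; exact: cpcontZ.
have [sp ap] := classical_sobolev2 dpsi cG.
have hp : ae_circle (helmholtz eps psi) f.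
  apply: ae_circle_trans (ae_circle_sym fF).
  by apply: filterS ap => y h yc; rewrite /helmholtz h // /eps2; ring.
set P := [set g | sobolev 2 g /\ ae_circle (helmholtz eps g) f].
have [] : P (op_inv (sobolev 2) (helmholtz eps) f).
  by apply: (@xgetPex _ (fun=> 0) P); exists psi.
set psi' := op_inv _ _ _ => s' h'.
have [E cE aE] : exists2 E, cpcont E & ae_circle psi' E.
  by apply: sobolev_continuous; case: s' => g w _; exists g => //; case: w.
have cG' : cpcont (fun y => eps2 * E y + F y) by apply: cpcontD => //; exact: cpcontZ.
have [|E' dE' aE'] := sobolev2_classical s' cG'.
  apply: filterS2 (ae_circle_trans h' fF) aE => y h1 h2 yc.
  by rewrite -h1 // -h2 // /helmholtz /eps2; ring.
have EE : E = E'.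
  apply: ae_cpcont_eq => //; first exact: has_deriv2_cpcont dE'.
  exact: ae_circle_trans (ae_circle_sym aE) aE'.
rewrite -EE in dE'.
by rewrite (helmholtz_classical_unique cF dpsi dE').
Qed.

End Helmholtz.

End SobolevFunctions.

(** * Assembly of the eigenvalue problem *)

Section Spectrum.
Context (R : realType).
Implicit Types (a b x y : R) (u : R -> R) (z w c : R[i]) (f g h k v : R -> R[i]).
Local Notation mu := (@lebesgue_measure R).
Local Notation per := (pi *+ 2 : R).
Local Notation Int f := (\int[mu]_(y in circle) f y).

Local Notation normc := (@Normc.normc R).
Local Notation Re := (@complex.Re R).
Local Notation Im := (@complex.Im R).

Lemma real_complexD (x y : R) : (x + y)%:C = x%:C + y%:C :> R[i].
Proof. exact: rmorphD. Qed.

Lemma real_complexB (x y : R) : (x - y)%:C = x%:C - y%:C :> R[i].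
Proof. exact: rmorphB. Qed.

Lemma real_complexN (x : R) : (- x)%:C = - x%:C :> R[i].
Proof. exact: rmorphN. Qed.

Lemma real_complexM (x y : R) : (x * y)%:C = x%:C * y%:C :> R[i].
Proof. exact: rmorphM. Qed.

Lemma sup_range_bound u y : pcont u -> `|u y| <= sup (range (fun x => `|u x|)).
Proof.
move=> /pcont_bounded[B _ uB]; apply: ub_le_sup; last by exists y.
by exists B => _ [x _ <-].
Qed.

Lemma is_Ck2_profile u : is_Ck 2 u -> Int u = 0 ->
  profile u (derive1 u) (derive1n 2 u) (Ck_norm 2 u).
Proof.
move=> [pu d c2] Iu.
have d0 : has_deriv u (derive1 u).
  by move=> y; rewrite derive1E; apply: derivableP; exact: (d 0%N y).
have d1 : has_deriv (derive1 u) (derive1n 2 u).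
  by move=> y; rewrite /derive1n /= derive1E; apply: derivableP; exact: (d 1%N y).
have p0 : pcont u by split => //; exact: has_deriv_continuous d0.
have p1 : pcont (derive1 u).
  by split; [exact: has_deriv_periodic d0 pu|exact: has_deriv_continuous d1].
have p2 : pcont (derive1n 2 u).
  by split; [exact: has_deriv_periodic d1 (proj1 p1)|exact: c2].
have E : Ck_norm 2 u = sup (range (fun y => `|u y|)) +
    sup (range (fun y => `|derive1 u y|)) + sup (range (fun y => `|derive1n 2 u y|)).
  by rewrite /Ck_norm !big_ord_recr big_ord0 /= add0r.
have s0 (p : R -> R) : pcont p -> 0 <= sup (range (fun y => `|p y|)).
  by move=> pv; exact: le_trans (normr_ge0 _) (sup_range_bound 0 pv).
split => // y; rewrite E.
- by rewrite -addrA (le_trans (sup_range_bound y p0)) // lerDl addr_ge0 // s0.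
- by rewrite (le_trans (sup_range_bound y p2)) // lerDr addr_ge0 // s0.
Qed.

Section Eigenvalue.
Context (U U1 U2 : R -> R) (M : R) (UP : profile U U1 U2 M).
Context (nu eps beta eta b : R).
Context (nu0 : 0 < nu) (eps0 : 0 < eps) (beta0 : 0 < beta) (eta0 : 0 < eta).
Context (epsE : eps = nu * eta) (betaE : beta = nu * eps * b).
Context (h e : R -> R[i]).
Let eps2 : R[i] := (eps ^+ 2)%:C.
Let ib : R[i] := 'i * b%:C.
Context (se : sol eps2 e h) (sh : sol ib h (rhs U U2 eps beta eta h e)).

(** By [betaE] the middle term is i beta / eps. *)
Definition eigval : R[i] :=
  - (nu%:C * eps2) + nu%:C * ib - 'i * eps%:C * Umean U e.
Definition eigfun y : R[i] := h y - eps2.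
Definition eigpsi y : R[i] := 1 + e y.

(** [Lop] with the second derivative and the Helmholtz inverse passed as arguments, so that the
    eigenvalue equation becomes pure algebra. *)
Definition Lclass g g2 chi y : R[i] :=
  nu%:C * (g2 y - eps2 * g y)
  - 'i * eps%:C * ((U y)%:C * g y - (U2 y - beta)%:C * chi y).

Lemma epsEC : eps%:C = nu%:C * eta%:C :> R[i].
Proof. by rewrite [in LHS]epsE rmorphM. Qed.

Lemma betaEC : beta%:C = nu%:C * eps%:C * b%:C :> R[i].
Proof. by rewrite [in LHS]betaE !rmorphM. Qed.

Lemma eps2EC : eps2 = (nu%:C * eta%:C) ^+ 2.
Proof. by rewrite -epsEC /eps2 !expr2 real_complexM. Qed.

Definition eigfun2 y : R[i] := ib * h y + rhs U U2 eps beta eta h e y.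

Lemma cpcont_h : cpcont h. Proof. exact: sol_cpcont sh. Qed.
Lemma cpcont_eigfun : cpcont eigfun.
Proof. by apply: cpcontB; [exact: cpcont_h|exact: cpcont_cst]. Qed.

Lemma eigfun_deriv2 : has_deriv2 eigfun eigfun2.
Proof.
apply: has_deriv2_eq (has_deriv2B (sol_has_deriv2 sh) (has_deriv2_cst eps2)) _ => y.
by rewrite subr0.
Qed.

Lemma cpcont_eigfun2 : cpcont eigfun2.
Proof.
apply: cpcontD; first exact: cpcontZ cpcont_h.
have mh := sol_mean0P sh.
by case: (mean0_rhs UP beta eta (eps := eps) se mh).
Qed.

Lemma eigpsi_deriv2 : has_deriv2 eigpsi (fun y => eps2 * eigpsi y + eigfun y).
Proof.
apply: has_deriv2_eq (has_deriv2D (has_deriv2_cst 1) (sol_has_deriv2 se)) _ => y.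
by rewrite /eigpsi /eigfun; ring.
Qed.

Lemma cmean_eigfun : cmean eigfun = - eps2.
Proof.
rewrite cmeanB ?cmean_cst; [|exact: cpcont_h|exact: cpcont_cst].
by rewrite (proj2 (cmean0P _) (sol_mean0 sh)) sub0r.
Qed.

(** Since [epsE] and [betaE] are free of divisions, everything is polynomial in nu, eta, b and the
    values at y. *)
Lemma eigen_classical y : Lclass eigfun eigfun2 eigpsi y = eigval * eigfun y.
Proof.
rewrite /Lclass /eigval /eigfun2 /rhs /Qform /forcing /eigfun /eigpsi.
rewrite real_complexB real_complexD (real_complexM (eps ^+ 2)).
rewrite -/eps2 eps2EC betaEC epsEC /ib; ring.
Qed.

Lemma Lop_classical g G g2 chi : cpcont G -> ae_circle g G ->
  ae_circle (Dyn 2 g) g2 -> has_deriv2 chi (fun y => eps2 * chi y + G y) ->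
  U2 = derive1n 2 U -> ae_circle (Lop U nu eps beta g) (Lclass G g2 chi).
Proof.
move=> cG gG Dg dchi U2E; have := op_inv_helmholtz eps0 cG gG dchi.
move=> Ho; have H2 : ae_circle (fun y => Dyn 2 g y - eps2 * g y) (fun y => g2 y - eps2 * G y).
  by apply: filterS2 Dg gG => y h1 h2 yc; rewrite h1 // h2.
have H3 : ae_circle (fun y => (U y)%:C * g y) (fun y => (U y)%:C * G y).
  by apply: filterS gG => y h1 yc; rewrite h1.
apply: filterS2 (filterI H2 H3) Ho => y [h1 h2] h3 yc.
by rewrite /Lop /Lclass /helmholtz -U2E h1 // h2 // h3.
Qed.

Context (eps_small : eps ^+ 2 <= eta * (1 + beta)).
Context (eta_small : eta * (1 + beta) <= 1).
Context (eta_Lam : Kper R * (eta * (1 + beta) * Lam M) <= 1 / 2).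
Context (h1 : forall y, normc (h y) <= 1).

Lemma nuC_neq0 : nu%:C != 0 :> R[i].
Proof. by rewrite fmorph_eq0 lt0r_neq0. Qed.

(** With arbitrary [a] this covers eigenvectors and Jordan chains at once. *)
Lemma resolvent_classical G G2 chi (a : R[i]) : has_deriv2 G G2 -> cpcont G2 ->
  has_deriv2 chi (fun y => eps2 * chi y + G y) ->
  (forall y, Lclass G G2 chi y - eigval * G y = a * eigfun y) ->
  exists c, G = fun y => c * eigfun y.
Proof.
move=> dG cG2 dchi HL.
have e20 := eps2_neq0 eps0; rewrite -/eps2 in e20.
have cG := has_deriv2_cpcont dG; have cchi := has_deriv2_cpcont dchi.
have cf := cpcont_eigfun; have cpsi := has_deriv2_cpcont eigpsi_deriv2.
(* As [eigfun] has mean -eps^2, this makes G - c [eigfun] mean-free. *)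
pose c := - (cmean G / eps2); exists c.
pose d y := G y - c * eigfun y; pose x y := chi y - c * eigpsi y.
have cd : cpcont d by apply: cpcontB => //; exact: cpcontZ.
have cx : cpcont x by apply: cpcontB => //; exact: cpcontZ.
have Id : cmean d = 0.
  rewrite /d cmeanB //; last exact: cpcontZ.
  by rewrite cmeanZ // cmean_eigfun /c mulrN mulNr opprK divfK ?subrr.
have dx : has_deriv2 x (fun y => eps2 * x y + d y).
  apply: has_deriv2_eq (has_deriv2B dchi (has_deriv2Z c eigpsi_deriv2)) _ => y.
  by rewrite /x /d; ring.
have Ix : cmean x = 0.
  have /cmean0P := has_deriv2_mean dx (cpcontD (cpcontZ eps2 cx) cd).
  rewrite cmeanD //; last exact: cpcontZ.
  rewrite Id addr0 cmeanZ // => /eqP; rewrite mulf_eq0 (negbTE e20) /= => /eqP ->//.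
have sx : sol eps2 x d by apply: has_deriv2_sol dx _; exact/cmean0P.
pose d2 y := G2 y - c * eigfun2 y.
have dd : has_deriv2 d d2 by exact: has_deriv2B dG (has_deriv2Z c eigfun_deriv2).
have cd2 : cpcont d2.
  by apply: cpcontB => //; apply: cpcontZ; exact: cpcont_eigfun2.
have HLd y : Lclass d d2 x y - eigval * d y = a * eigfun y.
  have -> : Lclass d d2 x y - eigval * d y = (Lclass G G2 chi y - eigval * G y)
      - c * (Lclass eigfun eigfun2 eigpsi y - eigval * eigfun y).
    by rewrite /Lclass /d /d2 /x; ring.
  by rewrite eigen_classical subrr mulr0 subr0 HL.
have cU := cpcontU UP; have cU2 := cpcontU2 UP.
have cUd := cpcontM cU cd; have cU2x := cpcontM cU2 cx.
(* In the mean of the equation only <U d> - <U'' x> = -eps^2 <U, x> survives on the left, against -a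
   eps^2 on the right. *)
have aE : a = - ('i * eps%:C * Umean U x).
  have I2 : cmean d2 = 0 by apply/cmean0P; exact: has_deriv2_mean dd cd2.
  have M1 := Umean_helmholtz UP cd sx.
  rewrite cmeanD ?cmean_cst in M1; [|exact: cpcontB|exact: cpcont_cst].
  have M2 : cmean (fun y => a * eigfun y) = a * - eps2 by rewrite cmeanZ // cmean_eigfun.
  have EL : (fun y => a * eigfun y) = (fun y => (nu%:C * d2 y - (nu%:C * eps2 + eigval) * d y)
      - 'i * eps%:C * (((U y)%:C * d y - (U2 y)%:C * x y) + beta%:C * x y)).
    by apply/funext => y; rewrite -HLd /Lclass real_complexB; ring.
  have cUx := cpcontB cUd cU2x; have cbx := cpcontZ beta%:C cx.
  rewrite EL (cmeanB (cpcontB (cpcontZ nu%:C cd2) (cpcontZ (nu%:C * eps2 + eigval) cd))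
    (cpcontZ ('i * eps%:C) (cpcontD cUx cbx))) in M2.
  rewrite (cmeanB (cpcontZ nu%:C cd2) (cpcontZ (nu%:C * eps2 + eigval) cd)) in M2.
  rewrite (cmeanZ nu%:C cd2) (cmeanZ (nu%:C * eps2 + eigval) cd) in M2.
  rewrite (cmeanZ ('i * eps%:C) (cpcontD cUx cbx)) (cmeanD cUx cbx) in M2.
  rewrite (cmeanZ beta%:C cx) Id I2 Ix !mulr0 addr0 subr0 sub0r in M2.
  have {}M1 : cmean (fun y => (U y)%:C * d y - (U2 y)%:C * x y) = - (eps2 * Umean U x).
    by apply/eqP; rewrite -addr_eq0 M1.
  rewrite M1 in M2; apply: (mulIf (_ : - eps2 != 0)); first by rewrite oppr_eq0.
  by rewrite -M2; ring.
(* With this [a], the term a (h - eps^2) yields the two terms of [Qform] in <U, x>, while the <U, e>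
   part of [eigval] multiplying [d] yields the last one. *)
have sd : sol ib d (fun y => 'i * eta%:C * Qform U U2 eps beta d x (Umean U x) h (Umean U e) y).
  apply: has_deriv2_sol; last exact/cmean0P.
  apply: has_deriv2_eq dd _ => y; apply: (mulfI nuC_neq0).
  have -> : nu%:C * d2 y = nu%:C * eps2 * d y
      + 'i * eps%:C * ((U y)%:C * d y - (U2 y - beta)%:C * x y)
      + eigval * d y + a * eigfun y.
    by rewrite -HLd /Lclass; ring.
  rewrite aE /eigval /Qform /eigfun real_complexB -/eps2.
  rewrite eps2EC epsEC /ib; ring.
have d0 := linearized_injective UP eta0 beta0 eps_small eta_small eta_Lam se sh h1 sx sd.
by apply/funext => y; apply/eqP; rewrite -subr_eq0; apply/eqP; exact: (congr1 (@^~ y) d0).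
Qed.

Lemma resolvent_kernel g (a : R[i]) : U2 = derive1n 2 U -> sobolev 2 g ->
  ae_circle (fun y => Lop U nu eps beta g y - eigval * g y) (fun y => a * eigfun y) ->
  exists c, ae_circle g (fun y => c * eigfun y).
Proof.
move=> U2E sg Hg.
have [G cG gG] : exists2 G, cpcont G & ae_circle g G.
  by apply: sobolev_continuous; case: sg => g' w _; exists g' => //; case: w.
have [chi dchi] := helmholtz_classical_exists eps0 cG.
have cchi := has_deriv2_cpcont dchi.
have cU := cpcontU UP; have cU2 := cpcontU2 UP.
(* The second derivative that the equation forces; being continuous, it makes [g] classical. *)
pose G2 y : R[i] := eps2 * G y + nu%:C^-1 *
  ('i * eps%:C * ((U y)%:C * G y - (U2 y - beta)%:C * chi y) + eigval * G y + a * eigfun y).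
have cG2 : cpcont G2.
  apply: cpcontD; first exact: cpcontZ.
  apply: cpcontZ; apply: cpcontD; last exact: cpcontZ cpcont_eigfun.
  apply: cpcontD; last exact: cpcontZ.
  apply: cpcontZ; apply: cpcontB; apply: cpcontM => //.
  have := cpcontB cU2 (cpcont_cst beta%:C); congr cpcont.
  by apply/funext => y; rewrite rmorphB.
have HG2 y : Lclass G G2 chi y - eigval * G y = a * eigfun y.
  rewrite /Lclass /G2 [eps2 * _ + _]addrC addrK mulrA divff ?nuC_neq0 // mul1r; ring.
have DG2 : ae_circle (Dyn 2 g) G2.
  have Ho := op_inv_helmholtz eps0 cG gG dchi.
  apply: filterS2 (filterI Hg gG) Ho => y [k1 k2] k3 yc.
  have {}k1 := k1 yc; have {}k2 := k2 yc; have {}k3 := k3 yc.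
  apply: (mulfI nuC_neq0); apply/eqP; rewrite -subr_eq0; apply/eqP.
  have := HG2 y; rewrite -k1 /Lop /Lclass /helmholtz -U2E k2 k3 => /eqP.
  rewrite eq_sym -subr_eq0 => /eqP <-; rewrite -/eps2; ring.
have [G' dG' gG'] := sobolev2_classical sg cG2 DG2.
have GG : G = G'.
  apply: ae_cpcont_eq => //; first exact: has_deriv2_cpcont dG'.
  exact: ae_circle_trans (ae_circle_sym gG) gG'.
rewrite -GG in dG'.
have [c Gc] := resolvent_classical dG' cG2 dchi HG2.
by exists c; rewrite -Gc.
Qed.

(** By induction on the power, (L - lambda) g is a multiple of [eigfun], which is the hypothesis of
    [resolvent_kernel]. The eigenfunction is nonzero because its mean is -eps^2. *)
Lemma eigval_simple : U2 = derive1n 2 U ->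
  simple_eigenvalue (sobolev 2) (Lop U nu eps beta) eigval.
Proof.
move=> U2E; have cf := cpcont_eigfun.
have [sf Df] := classical_sobolev2 eigfun_deriv2 cpcont_eigfun2.
exists eigfun; split => //.
- move=> /(ae_cpcont_eq cf (cpcont_cst 0)) f0.
  have := cmean_eigfun; rewrite f0 cmean_cst => /eqP.
  by rewrite eq_sym oppr_eq0 (negbTE (eps2_neq0 eps0)).
- have := Lop_classical cf (ae_circle_refl _) Df eigpsi_deriv2 U2E.
  by move/ae_circle_trans; apply; apply: aeW => y _; exact: eigen_classical.
- elim=> [|n IH] g /=.
    move=> g0; exists 0; apply: ae_circle_trans g0 _.
    by apply: aeW => y _; rewrite mul0r.
  move=> [sg /IH[a Ha]]; exact: resolvent_kernel U2E sg Ha.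
Qed.

End Eigenvalue.

(** * The fourth-order operator of the leading term *)

Section Biharmonic.
Context (U U1 U2 : R -> R) (M : R) (UP : profile U U1 U2 M).
Context (b : R) (b0 : 0 < b).
Let ib : R[i] := 'i * b%:C.
Context (v : R -> R[i]) (sv : sol ib v (fun y => (U y)%:C)).

Let Pre y : R[i] := (Re (v y))%:C.

(** With v = p + i q, the equation v'' = i b v + U reads p'' = U - b q and q'' = b p, whence p'''' +
    b^2 p = U''. *)
Lemma biharmonic_witness : exists2 W, has_deriv2 Pre W &
  has_deriv2 W (fun y => (U2 y)%:C - (b ^+ 2)%:C * Pre y).
Proof.
have [v1 [[dp dq] [dp1 dq1] [pv1 pv2] [pw1 pw2] _]] := sv.
pose W y : R[i] := (U y)%:C - b%:C * (Im (v y))%:C.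
have d1 : has_deriv2 Pre W.
  exists (fun y => (Re (v1 y))%:C); split.
  - exact: chas_deriv_real.
  - apply: chas_deriv_eq (chas_deriv_real dp1) _ => y.
    by rewrite /W -rmorphM -rmorphB; congr _%:C; rewrite /ib !ReImE /=; ring.
  - exact: cpcont_real.
  - exact: cpcont_real.
have d2 : has_deriv2 (fun y => (Im (v y))%:C) (fun y => b%:C * Pre y).
  exists (fun y => (Im (v1 y))%:C); split.
  - exact: chas_deriv_real.
  - apply: chas_deriv_eq (chas_deriv_real dq1) _ => y.
    by rewrite /Pre -rmorphM; congr _%:C; rewrite /ib !ReImE /=; ring.
  - exact: cpcont_real.
  - exact: cpcont_real.
have d3 : has_deriv2 (fun y => (U y)%:C) (fun y => (U2 y)%:C).
  exists (fun y => (U1 y)%:C); split.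
  - exact: chas_deriv_real (profile_deriv UP).
  - exact: chas_deriv_real (profile_deriv1 UP).
  - exact: cpcont_real (profile_pcont UP).
  - exact: cpcont_real (profile_pcont1 UP).
exists W => //; apply: has_deriv2_eq (has_deriv2B d3 (has_deriv2Z b%:C d2)) _ => y.
by rewrite expr2 rmorphM mulrA.
Qed.

(** Factorisation of d_y^4 + b^2 as (d_yy - i b)(d_yy + i b): q = Z'' + i b Z solves q'' = i b q, so
    it vanishes, and then Z'' = -i b Z. Both parameters have zero real part, and all means vanish
    because b is nonzero. *)
Lemma biharmonic_unique Z Y : has_deriv2 Z Y ->
  has_deriv2 Y (fun y => - ((b ^+ 2)%:C * Z y)) -> Z = fun=> 0.
Proof.
move=> dZ dY; have cZ := has_deriv2_cpcont dZ; have cY := has_deriv2_cpcont dY.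
have bC0 : b%:C != 0 :> R[i] by rewrite fmorph_eq0 lt0r_neq0.
have i2 : 'i * 'i = -1 :> R[i] by rewrite -expr2 sqrCi.
have IY := has_deriv2_mean dZ cY.
have IZ : cintegral Z = 0.
  have := has_deriv2_mean dY (cpcontN (cpcontZ _ cZ)).
  rewrite cintegralN ?cintegralZ //; last exact: cpcontZ.
  by move/eqP; rewrite oppr_eq0 rmorphXn mulf_eq0 expf_eq0 (negbTE bC0) /= => /eqP.
have sol0 z : sol z (fun=> 0) (fun=> 0).
  apply: has_deriv2_sol; last by rewrite cintegral_cst mulr0.
  by apply: has_deriv2_eq (has_deriv2_cst 0) _ => y; rewrite mulr0 addr0.
have Rib : Re ib = 0 by rewrite /ib /= mul0r mulr0 subr0.
pose q y := Y y + ib * Z y.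
have dq : has_deriv2 q (fun y => ib * q y + (fun=> 0) y).
  apply: has_deriv2_eq (has_deriv2D dY (has_deriv2Z ib dZ)) _ => y.
  rewrite /q /ib /= addr0 mulrDr [RHS]addrC; congr (_ + _).
  by rewrite mulrA mulrACA i2 -rmorphM -expr2 mulN1r mulNr.
have Iq : cintegral q = 0.
  by rewrite cintegralD ?cintegralZ // ?IY ?IZ ?mulr0 ?addr0 //; exact: cpcontZ.
have q0 : q = fun=> 0.
  by apply: sol_unique (has_deriv2_sol dq Iq) (sol0 ib); rewrite Rib.
have dZ' : has_deriv2 Z (fun y => - ib * Z y + (fun=> 0) y).
  apply: has_deriv2_eq dZ _ => y; have := congr1 (@^~ y) q0; rewrite /q /= addr0 => /eqP.
  by rewrite addr_eq0 mulNr => /eqP.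
by apply: sol_unique (has_deriv2_sol dZ' IZ) (sol0 (- ib)); rewrite ReImE Rib oppr0.
Qed.

Lemma sobolevW n f : sobolev n.+1 f -> sobolev n f.
Proof.
elim: n f => [|n IH] f; first by case=> g [].
by move=> [g w s]; exists g => //; exact: IH.
Qed.

Lemma op_inv_biharmonic :
  let B := op_inv (sobolev 4) (biharmonic (b ^+ 2)) (fun y => (U2 y)%:C) in
  sobolev 4 B /\ ae_circle B Pre.
Proof.
move=> B; have [W d1 d2] := biharmonic_witness.
have cP := has_deriv2_cpcont d1; have cU2 := cpcontU2 UP.
have cH : cpcont (fun y => (U2 y)%:C - (b ^+ 2)%:C * Pre y).
  by apply: cpcontB => //; exact: cpcontZ.
have [sP aP] := classical_sobolev4 d1 d2 cH.
set P := [set f | sobolev 4 f /\ ae_circle (biharmonic (b ^+ 2) f) (fun y => (U2 y)%:C)].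
have [sB aB] : P B.
  apply: (@xgetPex _ (fun=> 0) P); exists Pre; split => //.
  by apply: filterS aP => y hy yc; rewrite /biharmonic hy // subrK.
split => //.
have sB2 : sobolev 2 B by do 2 apply: sobolevW.
have [E cE aE] := sobolev_continuous (sobolevW sB2).
have cK : cpcont (fun y => (U2 y)%:C - (b ^+ 2)%:C * E y).
  by apply: cpcontB => //; exact: cpcontZ.
have sD : sobolev 2 (Dyn 2 B) by case: (sobolevS sB) => _ /sobolevS[].
(* [Dyn 4 B] is [Dyn 2 (Dyn 2 B)] by computation, so the second-order regularity result is applied
   twice. *)
have [W' dW' aW'] : exists2 F, has_deriv2 F (fun y => (U2 y)%:C - (b ^+ 2)%:C * E y) &
    ae_circle (Dyn 2 B) F.
  apply: sobolev2_classical => //.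
  by apply: filterS2 aB aE => y k1 k2 yc; rewrite -k1 // -k2 // /biharmonic addrK.
have [E' dE' aE'] := sobolev2_classical sB2 (has_deriv2_cpcont dW') aW'.
have EE : E = E'.
  apply: ae_cpcont_eq => //; first exact: has_deriv2_cpcont dE'.
  exact: ae_circle_trans (ae_circle_sym aE) aE'.
rewrite -EE in dE'.
have Z0 : (fun y => E y - Pre y) = fun=> 0.
  apply: biharmonic_unique (has_deriv2B dE' d1) _.
  by apply: has_deriv2_eq (has_deriv2B dW' d2) _ => y; ring.
apply: ae_circle_trans aE _; apply: aeW => y _.
by apply/eqP; rewrite -subr_eq0; apply/eqP; exact: (congr1 (@^~ y) Z0).
Qed.

Lemma inner_biharmonic :
  inner (fun y => (U y)%:C)
    (op_inv (sobolev 4) (biharmonic (b ^+ 2)) (fun y => (U2 y)%:C)) =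
  (Re (Umean U v))%:C.
Proof.
have [sB aB] := op_inv_biharmonic; move: sB aB; set B := op_inv _ _ _ => sB aB.
have LB : L2 B by do 4 move/sobolevW: sB => sB.
have [i1 i2] := L2_cinteg LB; have [_ cU] := profile_pcont UP.
have [[_ cv1] [_ cv2]] := sol_cpcont sv.
rewrite /inner /Umean /cmean.
have -> : (fun y => ((U y)%:C)^* * B y) = (fun y => B y * (U y)%:C).
  by apply/funext => y; rewrite mulrC; congr (_ * _); exact: conjc_real.
rewrite cintegral_test.
have -> : (fun y => (U y)%:C * v y) = (fun y => v y * (U y)%:C).
  by apply/funext => y; rewrite mulrC.
rewrite cintegral_test.
have -> : Int (fun y => Re (B y) * U y) = Int (fun y => Re (v y) * U y).
  apply: ae_eq_Int; [exact: cintegM|exact/continuous_cinteg/continuousM_fun|].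
  by apply: filterS aB => y hy yc; rewrite hy.
have -> : Int (fun y => Im (B y) * U y) = 0.
  rewrite -[RHS](_ : Int (fun=> 0) = 0); last by rewrite Int_cst mulr0.
  apply: ae_eq_Int; first exact: cintegM.
    by apply: continuous_cinteg => ?; exact: cst_continuous.
  by apply: filterS aB => y hy yc; rewrite hy // mul0r.
by apply: complex_eqP; rewrite !ReImE /=; ring.
Qed.

End Biharmonic.

End Spectrum.

(** * Choice of the constants and the real part of the eigenvalue *)

Theorem theorem1p1 (R : realType) :
  exists delta : R -> R, (forall M : R, 0 < delta M) /\
  forall U : R -> R,
    is_Ck 2 U ->
    \int[lebesgue_measure]_(y in circle) U y = 0 ->
    exists2 C : R, 0 < C &
    forall nu eps beta : R, 0 < nu -> 0 < eps -> 0 < beta ->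
      eps / nu * (1 + beta) < delta (Ck_norm 2 U) ->
      eps < beta / nu ->
      exists2 lambda : R[i],
        simple_eigenvalue (sobolev 2) (Lop U nu eps beta) lambda &
        exists2 r : R,
          `|r| <= C * (eps / nu * (1 + beta) ^+ 3) &
          (complex.Re lambda)%:C =
            (eps ^+ 2 / nu)%:C *
            (- (nu ^+ 2)%:C
             - inner (fun y => (U y)%:C)
                 (op_inv (sobolev 4)
                    (biharmonic (beta ^+ 2 / (eps ^+ 2 * nu ^+ 2)))
                    (fun y => (derive1n 2 U y)%:C))
             + r%:C).
Proof.
have K0 := Kper_gt0 R.
have LamP (M : R) : 0 <= M -> 0 <= Lam M by move=> M0; rewrite /Lam; nonneg.
(* The two summands give the contraction factor 1/2 and the bound eta (1 + beta) <= 1. The absolute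
   value keeps delta positive for every real argument. *)
exists (fun M => (2 * (Kper R * Lam `|M|) + 1)^-1); split.
  move=> M; rewrite invr_gt0; apply: ltr_wpDl => //; have := LamP _ (normr_ge0 M) => ?.
  by nonneg.
move=> U CU IU; have UP := is_Ck2_profile CU IU; have M0 := M_ge0 UP.
move: UP M0; set M := Ck_norm 2 U => UP M0.
have C0 : 0 <= ConstC M.
  by have := LamP _ M0 => ?; rewrite /ConstC; nonneg.
exists (ConstC M + 1); first by apply: ltr_wpDl.
move=> nu eps beta nu0 eps0 beta0; rewrite ger0_norm // => small eps_beta.
pose eta := eps / nu; pose b := beta / (eps * nu).
have nun0 := lt0r_neq0 nu0; have epsn0 := lt0r_neq0 eps0.
have eta0 : 0 < eta by rewrite divr_gt0.
have b0 : 0 < b by rewrite divr_gt0 // mulr_gt0.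
have epsE : eps = nu * eta by rewrite /eta mulrC divfK.
have betaE : beta = nu * eps * b by rewrite /b; field; rewrite nun0 epsn0.
have beta1 : 0 < 1 + beta by rewrite addr_gt0.
(* Here eps^2 = eta (nu eps), and nu eps < beta by the second smallness hypothesis. *)
have eps_small : eps ^+ 2 <= eta * (1 + beta).
  rewrite expr2 {1}epsE [nu * eta]mulrC -mulrA ler_wpM2l ?ltW //.
  by move: eps_beta; rewrite ltr_pdivlMr // mulrC; lra.
have LK0 : 0 <= Kper R * Lam M by have := LamP _ M0 => ?; nonneg.
have {small} : eta * (1 + beta) * (2 * (Kper R * Lam M) + 1) < 1.
  by rewrite -ltr_pdivlMr ?mul1r //; apply: ltr_wpDl => //; nonneg.
have eb0 : 0 < eta * (1 + beta) by rewrite mulr_gt0.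
rewrite mulrDr mulr1 => small.
have eta_small : eta * (1 + beta) <= 1.
  have : 0 <= eta * (1 + beta) * (2 * (Kper R * Lam M)) by nonneg.
  by lra.
have eta_Lam : Kper R * (eta * (1 + beta) * Lam M) <= 1 / 2.
  have -> : Kper R * (eta * (1 + beta) * Lam M) =
      eta * (1 + beta) * (2 * (Kper R * Lam M)) / 2 by field.
  by lra.
have [h [e [se sh h1]]] := nonlinear_solution UP b eta0 beta0 eps_small eta_small eta_Lam.
exists (eigval U nu eps b e).
  exact: (eigval_simple UP nu0 eps0 beta0 eta0 epsE betaE se sh eps_small eta_small eta_Lam h1).
have Rib : 0 <= complex.Re ('i * b%:C : R[i]) by rewrite /= mul0r mulr0 subr0.
have [v sv] := sol_exists Rib (mean0U UP).
have lead := leading_order UP eta0 beta0 eps_small eta_small eta_Lam se sh h1 sv.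
have -> : beta ^+ 2 / (eps ^+ 2 * nu ^+ 2) = b ^+ 2.
  by rewrite /b -exprMn expr_div_n.
rewrite (inner_biharmonic UP b0 sv).
pose m := complex.Re (Umean U v); pose t := complex.Im (Umean U e) + eta * m.
(* Re lambda = -nu eps^2 + eps Im <U, e>, and eps = (eps^2 / nu) / eta. The leading part of Im <U,
   e> is -eta m, so [t] is the error bounded by [leading_order]. *)
exists (t / eta).
  rewrite normrM normfV (gtr0_norm eta0) ler_pdivrMr //.
  have tE : t = complex.Im (Umean U e - - ('i * eta%:C) * Umean U v).
    by rewrite !ReImE /t /m /=; ring.
  rewrite tE (le_trans (normIm_le _)) // (le_trans lead) //.
  have b3 : 1 + beta <= (1 + beta) ^+ 3.
    rewrite exprS; apply: ler_peMr; first exact: ltW.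
    by apply: exprn_ege1; rewrite lerDl ltW.
  have -> : (ConstC M + 1) * (eps / nu * (1 + beta) ^+ 3) * eta =
    (ConstC M + 1) * (eta ^+ 2 * (1 + beta) ^+ 3) by rewrite -/eta; ring.
  apply: ler_pM => //; first by nonneg.
    by rewrite lerDl.
  by apply: ler_wpM2l => //; nonneg.
rewrite -!real_complexN -!real_complexD -real_complexM.
congr _%:C; rewrite -/m /eigval /t; move: (Umean U e) => s.
rewrite !ReImE /= /eta; field.
by rewrite epsn0 nun0.
Qed.
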